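(* Let $d\ge 1$ be a fixed integer and let $Y_t=\mu_t+\varepsilon_t$, $t=1,\dots,n$, where $\{\varepsilon_t\}$ is a mean zero stationary process, $\nabla^d\mu_t=\gamma_t$ with $\{\gamma_t\}$ i.i.d. with mean zero and variance $\tau^2/n^{2d-1}$ for a fixed constant $\tau>0$, and the error process $\{\varepsilon_t\}$ is independent of $\{\gamma_t\}$ (and of the trend $\mu$). Let $\hat\mu=\hat\mu(\nu)$ be the penalized least squares estimate of $\mu=(\mu_1,\dots,\mu_n)'$ with difference order $d$ and penalty parameter $\nu=\nu_n>0$, and let $\overline\mu=E(\hat\mu\mid\mu)$. If $\nu\to\infty$ and $\nu/n^{2d}\to 0$ as $n\to\infty$, then $$E\|\overline\mu-\mu\|^2/n=c_2\,(\nu^{1/(2d)}/n)^{2d-1}\left[1+O(\nu^{-1/(2d)})+O(\nu^{1/(2d)}/n)\right],$$ where $c_2=\tau^2\,\mathrm{Beta}(1+1/(2d),\,1-1/(2d))/(2d\pi)$.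
   Context: $\nabla$ is the backward difference operator, $\nabla x_t=x_t-x_{t-1}$, and $\nabla^d$ its $d$-th iterate; the relation $\nabla^d\mu_t=\gamma_t$ is used for $t=d+1,\dots,n$. Equivalently, $\mu_t$ is the sum of a polynomial in $t$ of degree at most $d-1$ (with coefficients fixed or random) and $\sum_{1\le j\le t}(-1)^{t-j}\binom{-d}{t-j}\gamma_j$. $\|\cdot\|$ is the Euclidean norm on $\mathbb{R}^n$, prime denotes transpose, and $\mathrm{Beta}(a,b)=\int_0^1 x^{a-1}(1-x)^{b-1}\,dx$. The penalized least squares estimate $\hat\mu(\nu)$ is the minimizer over $\mu\in\mathbb{R}^n$ of $\sum_{1\le t\le n}(Y_t-\mu_t)^2+\nu\sum_{d+1\le t\le n}(\nabla^d\mu_t)^2$. Explicitly, let $S_{-d}$ be the $n\times n$ lower triangular matrix with $(t,j)$ entry $(-1)^{t-j}\binom{d}{t-j}$ for $t\ge j$ (and $0$ for $t<j$), and let $\overline S_{-d}$ be the $(n-d)\times n$ matrix obtained by deleting its first $d$ rows; then $\hat\mu(\nu)=(I+\nu\,\overline S_{-d}'\overline S_{-d})^{-1}Y$ with $Y=(Y_1,\dots,Y_n)'$, and $\overline\mu=E(\hat\mu\mid\mu)=(I+\nu\,\overline S_{-d}'\overline S_{-d})^{-1}\mu$. *)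

(* Defs.v *)
From HB Require Import structures.
From mathcomp Require Import all_boot all_order all_algebra.
From mathcomp Require Import all_classical all_reals all_analysis.

Set Implicit Arguments.
Unset Strict Implicit.
Unset Printing Implicit Defensive.

Import Order.TTheory GRing.Theory Num.Theory.
Import numFieldNormedType.Exports.

Local Open Scope classical_set_scope.
Local Open Scope ring_scope.

(* A vector (x_1, ..., x_n) of R^n is represented by a sequence x : nat -> R of
   which only the values at 1, ..., n are ever used. *)

Section Sequences.
Context {R : realType}.
Implicit Types (d n : nat) (nu : R) (x y m : nat -> R).

(* [iter d nabla x t] depends only on x (t - d), ..., x t when d <= t. *)
Definition nabla x : nat -> R := fun t => x t - x t.-1.

Definition euclidean_norm n x : R := Num.sqrt (\sum_(1 <= t < n.+1) x t ^+ 2).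

Definition pls_criterion d n nu y m : R :=
  \sum_(1 <= t < n.+1) (y t - m t) ^+ 2
  + nu * \sum_(d.+1 <= t < n.+1) (iter d nabla m t) ^+ 2.

Definition is_pls_estimate d n nu y m : Prop :=
  forall m' : nat -> R, pls_criterion d n nu y m <= pls_criterion d n nu y m'.

(* The library's [beta_fun] takes natural number parameters only. *)
Definition Beta (a b : R) : R :=
  \int[lebesgue_measure]_(x in `[0, 1]) (x `^ (a - 1) * (1 - x) `^ (b - 1)).

End Sequences.

Section Probability.
Context {disp : measure_display} {T : measurableType disp} {R : realType}.
Variable P : probability T R.
Implicit Types (D : set nat) (X : nat -> T -> R) (F G : set (set T)).

Definition sigma_of D X : set (set T) :=
  <<s \bigcup_(t in D) preimage_set_system setT (X t) measurable >>.

Definition independent_sigma F G : Prop :=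
  forall A B, F A -> G B -> P (A `&` B) = (P A * P B)%E.

Definition mutually_independent D X : Prop :=
  forall (s : seq nat) (B : nat -> set R),
    uniq s -> (forall t, t \in s -> D t) -> (forall t, measurable (B t)) ->
    P (\bigcap_(t in [set` s]) (X t @^-1` B t)) =
      (\prod_(t <- s) P (X t @^-1` B t))%E.

(* Equality of laws is only required on measurable sets: a measure is an
   arbitrary function outside of them. *)
Definition identically_distributed D X : Prop :=
  forall s t, D s -> D t ->
    forall B : set R, measurable B -> P (X s @^-1` B) = P (X t @^-1` B).

Definition iid D X : Prop :=
  mutually_independent D X /\ identically_distributed D X.

(* Second-order (covariance) stationarity. *)
Definition stationary X : Prop :=
  [/\ forall t, ('E_P[(fun w => X t w ^+ 2)%R] < +oo)%E,
      forall s t, ('E_P[X s] = 'E_P[X t])%E &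
      forall s t h, covariance P (X (s + h)%N) (X (t + h)%N)
                    = covariance P (X s) (X t)].

(* Z is a version of E(X | G).  X need not be integrable, only sigma-integrable
   over G (second clause), because the polynomial part of a trend may have
   random coefficients without moments.  For an integrable X one may take A k
   to be the whole space, and this is the usual conditional expectation. *)
Definition is_conditional_expectation G (X Z : T -> R) : Prop :=
  [/\ forall B : set R, measurable B -> G (Z @^-1` B),
      exists A : nat -> set T,
        [/\ forall k, G (A k), \bigcup_k A k = setT &
            forall k, P.-integrable (A k) (EFin \o X)] &
      forall A, G A -> P.-integrable A (EFin \o X) ->
        P.-integrable A (EFin \o Z) /\
        (\int[P]_(w in A) (Z w)%:E = \int[P]_(w in A) (X w)%:E)%E].

End Probability.

(* Main.v *)
(** With D the matrix of the penalty and A = 1 + nu D'D one has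
    mubar - mu = - nu A^-1 D' gamma almost surely, hence the mean square bias is
    the variance of gamma times nu * tr (A^-1 - A^-2).  Completing D by d rows
    makes it a circulant matrix, and each added row changes tr (A^-1 - A^-2) by
    at most 2, by the Sherman-Morrison formula.  The circulant matrix is
    diagonalised by the real (Hartley) form of the discrete Fourier transform,
    and the trace becomes a Riemann sum of s^(2d) / (1 + s^(2d))^2 over the nodes
    s_j = 2 nu^(1/(2d)) sin (pi j / n).  The substitution
    x = s^(2d) / (1 + s^(2d)) turns the limit integral into the Beta integral. *)

Require Import Defs.
From HB Require Import structures.
From mathcomp Require Import all_boot all_order all_algebra.
From mathcomp Require Import all_classical all_reals all_analysis.
From mathcomp Require Import measurable_realfun ring lra zify.

Set Implicit Arguments.
Unset Strict Implicit.
Unset Printing Implicit Defensive.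

Import Order.TTheory GRing.Theory Num.Theory.
Import numFieldNormedType.Exports.

Local Open Scope classical_set_scope.
Local Open Scope ring_scope.

(** * Perturbation of the trace by rank-one terms *)

(** Write z for nu^(1/(2d)). The trace to be estimated has main term constant times n / z, so an
    absolute error O(1) is a relative error O(z / n), and an absolute error O(n / z^2) is a relative
    error O(1 / z): these are the two remainders of the statement. The O(1) errors come from the d
    rows that close up the difference matrix (its free boundary leaves D'D without an explicit
    spectrum) and from the total variation of the summand. The O(n / z^2) errors come from the
    unequal spacing of the sine nodes and from the tail of the Beta integral. No change of variables
    is carried out under an integral. With h(s) = 1 / (1 + s^(2d)), the Beta integrand is the
    inverse function of s -> 1 - h(s), so on a slice its integral is s times the decrement of h, up
    to the spacing. The mean value theorem turns that decrement into the summand, since s |h'(s)| =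
    2d s^(2d) / (1 + s^(2d))^2. On the probabilistic side the trend may lack moments; only its d-th
    differences enter the bias, and those have finite variance. *)

Section DominatesIdentity.
Context {R : realFieldType} {n : nat}.
Implicit Types (A B : 'M[R]_n) (u v w x y : 'cV[R]_n).

Definition dot u v : R := (u^T *m v) 0 0.

Lemma dotE u v : dot u v = \sum_i u i 0 * v i 0.
Proof. by rewrite /dot mxE; apply: eq_bigr => i _; rewrite mxE. Qed.

Lemma dotC u v : dot u v = dot v u.
Proof. by rewrite !dotE; apply: eq_bigr => i _; rewrite mulrC. Qed.

Lemma dotDr u v w : dot u (v + w) = dot u v + dot u w.
Proof. by rewrite /dot mulmxDr mxE. Qed.

Lemma dotDl u v w : dot (v + w) u = dot v u + dot w u.
Proof. by rewrite dotC dotDr dotC (dotC u w). Qed.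

Lemma dotZr a u v : dot u (a *: v) = a * dot u v.
Proof. by rewrite /dot -scalemxAr mxE. Qed.

Lemma dotNr u v : dot u (- v) = - dot u v.
Proof. by rewrite /dot mulmxN mxE. Qed.

Lemma dotNl u v : dot (- v) u = - dot v u.
Proof. by rewrite dotC dotNr dotC. Qed.

Lemma dot_mull A u v : dot (A *m u) v = dot u (A^T *m v).
Proof. by rewrite /dot trmx_mul mulmxA. Qed.

Lemma dot_ge0 u : 0 <= dot u u.
Proof. by rewrite dotE sumr_ge0// => i _; rewrite -expr2 sqr_ge0. Qed.

Lemma dot_eq0 u : dot u u <= 0 -> u = 0.
Proof.
move=> u0; have {u0} : dot u u == 0 by rewrite eq_le u0 dot_ge0.
rewrite dotE psumr_eq0 => [/allP u0|i _]; last by rewrite -expr2 sqr_ge0.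
apply/colP => i; rewrite mxE; apply/eqP.
by have := u0 i (mem_index_enum i); rewrite /= mulf_eq0 orbb.
Qed.

Lemma mxtrace_outer u v : \tr (u *m v^T) = dot u v.
Proof. by rewrite mxtrace_mulC trace_mx11 dotC. Qed.

Lemma outer_mul u v w : u *m v^T *m w = dot v w *: u.
Proof. by rewrite -mulmxA (mx11_scalar (v^T *m w)) mul_mx_scalar. Qed.

(** Symmetry and [A >= 1] in the Loewner order. This survives the rank-one updates and gives
    [B^2 <= B <= 1] for [B = invmx A] without any eigenvalues. *)
Definition dominates1 A := A^T = A /\ forall x, dot x x <= dot x (A *m x).

(** An eigenvalue [a] contributes [(a - 1) / a^2], which increases up to [a = 2] and then decreases:
    enlarging [A] can move the trace either way, so the perturbation bound is two-sided. *)
Definition trace_gap A := \tr (invmx A) - \tr (invmx A *m invmx A).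

(** If [A x = 0] then [dot x x <= dot x (A x) = 0]. Since [kermx] is a left kernel, such [x] are the
    transposed rows of [kermx A^T]. *)
Lemma dominates1_unit A : dominates1 A -> A \in unitmx.
Proof.
move=> [_ A1]; rewrite -unitmx_tr -row_free_unit -kermx_eq0.
apply/eqP/row_matrixP => i; rewrite row0; apply: trmx_inj; rewrite trmx0.
apply: dot_eq0; apply: le_trans (A1 _) _.
have /sub_kermxP := row_sub i (kermx A^T) => /(congr1 trmx).
by rewrite trmx_mul trmxK trmx0 => ->; rewrite /dot mulmx0 mxE.
Qed.

Lemma trmx_invmx A : dominates1 A -> (invmx A)^T = invmx A.
Proof. by move=> [As _]; rewrite trmx_inv As. Qed.

Lemma dot_invmx_ge A : dominates1 A ->
  forall y, dot (invmx A *m y) (invmx A *m y) <= dot y (invmx A *m y).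
Proof.
move=> dA y; have [_ /(_ (invmx A *m y))] := dA.
by rewrite mulKVmx ?dominates1_unit// [leRHS]dotC.
Qed.

(** With [B = invmx A], expand [|y - B y|^2 >= 0] and bound [|B y|^2] by [dot y (B y)]. *)
Lemma dot_invmx_le A : dominates1 A ->
  forall y, dot y (invmx A *m y) <= dot y y.
Proof.
move=> dA y; have := dot_invmx_ge dA y.
have := dot_ge0 (y - invmx A *m y).
rewrite !(dotDl, dotDr, dotNl, dotNr) (dotC _ y); lra.
Qed.

Section RankOne.
Variables (A : 'M[R]_n) (u : 'cV[R]_n) (c : R).
Hypotheses (dA : dominates1 A) (c_ge0 : 0 <= c).

Lemma dominates1_rank1 : dominates1 (A + c *: (u *m u^T)).
Proof.
have [As A1] := dA; split=> [|x].
  by rewrite linearD linearZ/= trmx_mul trmxK As.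
rewrite mulmxDl dotDr (le_trans (A1 x))// lerDl.
by rewrite -scalemxAl outer_mul !dotZr (dotC x u) mulrA -mulrA -expr2 mulr_ge0 ?sqr_ge0.
Qed.

Let B := invmx A.
Let w := B *m u.
Let b := dot u w.
Let k := c / (1 + c * b).

Let b_ge : dot w w <= b.
Proof. exact: dot_invmx_ge. Qed.

Let den_gt0 : 0 < 1 + c * b.
Proof. by rewrite ltr_pwDl// mulr_ge0// (le_trans (dot_ge0 w)). Qed.

Lemma sherman_morrison :
  invmx (A + c *: (u *m u^T)) = B - k *: (w *m w^T).
Proof.
have Au := dominates1_unit dA.
have A'u := dominates1_unit dominates1_rank1.
have Bs : B^T = B by exact: trmx_invmx.
rewrite -[RHS](mulKmx A'u) -[LHS]mulmx1; congr (_ *m _); apply/esym.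
have E1 : (A + c *: (u *m u^T)) *m B = 1%:M + c *: (u *m w^T).
  by rewrite mulmxDl mulmxV// -scalemxAl /w trmx_mul Bs mulmxA.
have E2 : (A + c *: (u *m u^T)) *m w = (1 + c * b) *: u.
  by rewrite mulmxDl /w mulKVmx// -scalemxAl outer_mul scalerA scalerDl scale1r.
rewrite mulmxBr E1 -scalemxAr mulmxA E2 -scalemxAl scalerA /k divfK ?gt_eqF//.
by rewrite addrK.
Qed.

(** The difference is [k |w|^2 - 2 k w.Bw + k^2 |w|^4]. Each of [k |w|^2], [k w.Bw] and [k^2 |w|^4]
    lies in [0, 1], because [k |w|^2 <= c b / (1 + c b)]; hence the bound 2, uniformly in [c]. *)
Lemma trace_gap_rank1 : `|trace_gap A - trace_gap (A + c *: (u *m u^T))| <= 2.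
Proof.
rewrite /trace_gap sherman_morrison -/B.
have Bs : B^T = B by exact: trmx_invmx.
have k_ge0 : 0 <= k by rewrite divr_ge0// ltW.
have kw : k * dot w w <= 1.
  rewrite (@le_trans _ _ (k * b))// ?ler_wpM2l//.
  by rewrite /k mulrAC ler_pdivrMr// mul1r lerDr.
have kw0 : 0 <= k * dot w w by rewrite mulr_ge0// dot_ge0.
have kBw : k * dot w (B *m w) <= k * dot w w by rewrite ler_wpM2l// dot_invmx_le.
have kBw0 : 0 <= k * dot w (B *m w).
  by rewrite mulr_ge0// (le_trans (dot_ge0 (B *m w))) ?dot_invmx_ge.
have -> : (B - k *: (w *m w^T)) *m (B - k *: (w *m w^T)) =
    B *m B - k *: (B *m w *m w^T) - k *: (w *m (B *m w)^T)
    + (k ^+ 2 * dot w w) *: (w *m w^T).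
  have WW : w *m w^T *m (w *m w^T) = dot w w *: (w *m w^T).
    by rewrite mulmxA outer_mul -scalemxAl.
  have WB : w *m w^T *m B = w *m (B *m w)^T by rewrite (trmx_mul B w) Bs mulmxA.
  rewrite mulmxBl !mulmxBr -!scalemxAr -!scalemxAl WW WB mulmxA !scalerA expr2.
  by rewrite opprB addrA addrAC.
have trN (X : 'M[R]_n) : \tr (- X) = - \tr X by exact: raddfN.
rewrite !(mxtraceD, trN, mxtraceZ) !mxtrace_outer (dotC (B *m w)).
have sq : (k * dot w w) * (k * dot w w) <= 1 by rewrite mulr_ile1.
have sq0 : 0 <= (k * dot w w) * (k * dot w w) by rewrite mulr_ge0.
have E : k ^+ 2 * dot w w * dot w w = (k * dot w w) * (k * dot w w) by ring.
rewrite E ler_norml; apply/andP; split; lra.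
Qed.

End RankOne.

(** [p] counts the omitted first rows: [p = d] gives the matrix of the estimate and [p = 0] its
    circulant completion. *)
Definition penalty_mx (c : R) (U : 'I_n -> 'cV[R]_n) (p : nat) : 'M[R]_n :=
  1%:M + c *: \sum_(i < n | (p <= i)%N) (U i *m (U i)^T).

Lemma dominates1_penalty c U p : 0 <= c -> dominates1 (penalty_mx c U p).
Proof.
move=> c0; rewrite /penalty_mx scaler_sumr.
elim/big_rec : _ => [|i M _ dM].
  by rewrite addr0; split=> [|x]; rewrite ?trmx1// mul1mx.
by rewrite addrCA addrC; exact: dominates1_rank1.
Qed.

Lemma trace_gap_penalty c U p : 0 <= c -> (p <= n)%N ->
  `|trace_gap (penalty_mx c U p) - trace_gap (penalty_mx c U 0)| <= (2 * p)%:R.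
Proof.
move=> c0; elim: p => [_|p IHp pn]; first by rewrite subrr normr0.
have E : penalty_mx c U p =
    penalty_mx c U p.+1 + c *: (U (Ordinal pn) *m (U (Ordinal pn))^T).
  rewrite /penalty_mx (bigD1 (Ordinal pn))//= scalerDr addrCA addrC.
  congr (_ + _ *: _ + _); apply: eq_bigl => i.
  by rewrite andbC [RHS]ltn_neqAle eq_sym.
have := trace_gap_rank1 (U (Ordinal pn)) (dominates1_penalty U p.+1 c0) c0.
rewrite -E => h; have := IHp (ltnW pn) => {}IHp.
apply: le_trans (ler_distD (trace_gap (penalty_mx c U p)) _ _) _.
by rewrite mulnS natrD lerD.
Qed.

Lemma dot_penalty c U p x :
  dot x (penalty_mx c U p *m x) =
  dot x x + c * \sum_(i < n | (p <= i)%N) dot (U i) x ^+ 2.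
Proof.
rewrite mulmxDl mul1mx dotDr -scalemxAl dotZr mulmx_suml; congr (_ + _ * _).
rewrite /dot mulmx_sumr summxE; apply: eq_bigr => i _.
by rewrite outer_mul -scalemxAr mxE -/(dot x (U i)) (dotC x) expr2.
Qed.

(** The criterion is the quadratic [|y|^2 - 2 y.z + z.Az]. Tested against [z = invmx A *m y],
    minimality gives [(x - z).A(x - z) <= 0], and domination of the identity forces [x = z]. *)
Lemma penalized_min c U p x y : 0 <= c ->
  (forall z, dot (y - x) (y - x) + c * \sum_(i < n | (p <= i)%N) dot (U i) x ^+ 2 <=
             dot (y - z) (y - z) + c * \sum_(i < n | (p <= i)%N) dot (U i) z ^+ 2) ->
  x = invmx (penalty_mx c U p) *m y.
Proof.
move=> c0 xmin; have dA := dominates1_penalty U p c0.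
set A := penalty_mx c U p in dA *.
have E z : dot (y - z) (y - z) + c * \sum_(i < n | (p <= i)%N) dot (U i) z ^+ 2 =
    dot y y - 2 * dot y z + dot z (A *m z).
  rewrite dot_penalty !(dotDl, dotDr, dotNl, dotNr) (dotC z y); ring.
set z := invmx A *m y; have Az : A *m z = y by rewrite mulKVmx// dominates1_unit.
have {xmin} := xmin z; rewrite !E Az => xz.
apply/subr0_eq/dot_eq0; have [As /(_ (x - z))/le_trans] := dA; apply.
rewrite mulmxBr !(dotDl, dotDr, dotNl, dotNr) Az.
have -> : dot z (A *m x) = dot y x by rewrite -[X in dot z (X *m _)]As -dot_mull Az.
by move: xz; rewrite (dotC x y) (dotC z y); lra.
Qed.

(* With [D] the matrix whose rows are the [U i], [p <= i], the sum is the
   squared Frobenius norm of [(invmx A) D^T], and [c D^T D = A - 1]. *)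
Lemma sum_sqr_penalty c U p : 0 <= c ->
  let A := penalty_mx c U p in
  c * \sum_t \sum_(i < n | (p <= i)%N) (invmx A *m U i) t 0 ^+ 2 = trace_gap A.
Proof.
move=> c0 A; have dA : dominates1 A := dominates1_penalty U p c0.
have -> : trace_gap A = \tr (invmx A *m (A - 1%:M) *m invmx A).
  by rewrite mulmxBr mulmx1 mulVmx ?dominates1_unit// mulmxBl mul1mx linearB.
have -> : A - 1%:M = c *: \sum_(i < n | (p <= i)%N) (U i *m (U i)^T).
  by rewrite /A /penalty_mx addrC addKr.
rewrite -scalemxAr -scalemxAl linearZ/=; congr (_ * _).
rewrite mulmx_sumr mulmx_suml linear_sum/= exchange_big/=; apply: eq_bigr => i _.
have -> : invmx A *m (U i *m (U i)^T) *m invmx A =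
    (invmx A *m U i) *m (invmx A *m U i)^T.
  by rewrite trmx_mul trmx_invmx// !mulmxA.
by rewrite mxtrace_outer dotE; apply: eq_bigr => t _; rewrite expr2.
Qed.

End DominatesIdentity.

(** * The cyclic difference matrix and its spectrum *)

Section CyclicDifference.
Context {R : realType} {m : nat}.
Local Notation n := m.+1.

(** [ord_pred] is cyclic, so [1 - shift_mx] is the backward difference in which the last entry
    precedes the first. *)
Definition shift_mx : 'M[R]_n := \matrix_(i, j) (j == ord_pred i)%:R.

Definition diff_row (d : nat) (i : 'I_n) : 'cV[R]_n :=
  (row i ((1 - shift_mx) ^+ d))^T.

Definition sample (x : nat -> R) : 'cV[R]_n := \col_i x i.+1.

Lemma mul_shift_mx p (M : 'M[R]_(n, p)) i j :
  (shift_mx *m M) i j = M (ord_pred i) j.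
Proof.
rewrite mxE (bigD1 (ord_pred i))//= mxE eqxx mul1r big1 ?addr0// => k ki.
by rewrite mxE (negbTE ki) mul0r.
Qed.

Lemma mul_shift_mx_tr p (M : 'M[R]_(n, p)) i j :
  (shift_mx^T *m M) i j = M (ordS i) j.
Proof.
rewrite mxE (bigD1 (ordS i))//= !mxE ordSK eqxx mul1r big1 ?addr0// => k ki.
rewrite !mxE -[i in i == _]ordSK (inj_eq (@ord_pred_inj _)) eq_sym (negbTE ki).
by rewrite mul0r.
Qed.

Lemma dot_diff_row d (i : 'I_n) x :
  dot (diff_row d i) x = ((1 - shift_mx) ^+ d *m x) i 0.
Proof. by rewrite /dot trmxK -row_mul mxE. Qed.

(** The [d]-th difference at [i] reaches back to [i - d >= 0] only, so it never wraps around. The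
    rows below [d], which do wrap, are the ones added to the penalty. *)
Lemma dot_diff_row_sample d (i : 'I_n) x : (d <= i)%N ->
  dot (diff_row d i) (sample x) = iter d nabla x i.+1.
Proof.
rewrite dot_diff_row; elim: d i => [|d IHd] i di.
  by rewrite expr0 mul1mx mxE.
rewrite exprS -mulmxE -mulmxA mulmxBl mul1mx mxE [X in _ + X]mxE mul_shift_mx.
have pi : ord_pred i = i.-1 :> nat.
  rewrite /= addnS/= -[in LHS](ltn_predK di) addSnnS modnDr modn_small//.
  by rewrite (leq_ltn_trans (leq_pred i)).
rewrite !IHd; [|by rewrite pi -ltnS (ltn_predK di)|exact: ltnW].
by rewrite pi /= (ltn_predK di).
Qed.

Let theta (j : nat) : R := (pi *+ 2) * j%:R / n%:R.

Let thetaC (i j : nat) : theta j * i%:R = theta i * j%:R.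
Proof. rewrite /theta; ring. Qed.

Let theta_period (j : nat) : theta j * n%:R = (pi *+ 2) *+ j.
Proof. by rewrite /theta divfK ?pnatr_eq0// mulr_natr. Qed.

(** The kernel of the Hartley transform. It keeps the diagonalisation over the reals, with a
    symmetric matrix that is its own inverse up to the factor [n]. *)
Definition cas (x : R) := cos x + sin x.

Lemma casD2pi x k : cas (x + (pi *+ 2) *+ k) = cas x.
Proof. by rewrite /cas (periodicn (@cosD2pi R)) (periodicn (@sinD2pi R)). Qed.

Lemma casDB x y : cas (x + y) + cas (x - y) = 2 * cos y * cas x.
Proof. by rewrite /cas cosD sinD cosB sinB; ring. Qed.

Lemma cas_mul x y : cas x * cas y = cos (x - y) + sin (x + y).
Proof. by rewrite /cas cosB sinD; ring. Qed.

Let cas_mod (j k : nat) : cas (theta j * (k %% n)%:R) = cas (theta j * k%:R).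
Proof.
have -> : theta j * k%:R = theta j * (k %% n)%:R + (pi *+ 2) *+ (j * (k %/ n)).
  by rewrite mulrnA -theta_period -mulr_natr {1}(divn_eq k n) natrD natrM; ring.
by rewrite casD2pi.
Qed.

(** The term at 0 vanishes, and the reflection of [i] into [n - i] changes the sign of the
    others. *)
Lemma sum_sin_period (a : R) k : a * n%:R = (pi *+ 2) *+ k ->
  \sum_(i < n) sin (a * i%:R) = 0.
Proof.
move=> an; rewrite big_ord_recl mulr0 sin0 add0r.
suff E : \sum_(i < m) sin (a * (lift ord0 i)%:R) =
    - \sum_(i < m) sin (a * (lift ord0 i)%:R) by lra.
rewrite {1}(reindex_inj rev_ord_inj)/= -sumrN; apply: eq_bigr => i _.
rewrite -sinN -[RHS](periodicn (@sinD2pi R) k) -an; congr sin.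
rewrite /bump /= !add1n -subSn; last exact: ltn_ord.
by rewrite natrB; [ring|exact: (leq_trans (ltn_ord i))].
Qed.

(** After multiplication by [sin (a / 2)] the sum telescopes: each term is half the difference of
    the sines at [a i + a / 2] and [a i - a / 2]. *)
Lemma sum_cos_period (a : R) k : a * n%:R = (pi *+ 2) *+ k -> sin (a / 2) != 0 ->
  \sum_(i < n) cos (a * i%:R) = 0.
Proof.
move=> an a0; apply: (mulfI a0); rewrite mulr0 mulr_sumr.
pose g (i : nat) := sin (a * i%:R - a / 2) / 2.
rewrite (eq_bigr (fun i : 'I_n => g i.+1 - g i)); last first.
  move=> i _; rewrite /g -[i.+1%:R]natr1.
  have -> : a * (i%:R + 1) - a / 2 = a * i%:R + a / 2 by lra.
  by rewrite sinB sinD; lra.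
rewrite -(big_mkord xpredT (fun i => g i.+1 - g i)) telescope_sumr//.
by rewrite /g an mulr0 add0r [X in sin X]addrC (periodicn (@sinD2pi R)) subrr.
Qed.

Definition hartley : 'M[R]_n := \matrix_(i, j) cas (theta j * i%:R).

Let sum_cos (i j : nat) : (i < j < n)%N ->
  \sum_(k < n) cos (theta i * k%:R - theta j * k%:R) = 0.
Proof.
move=> /andP[ij jn].
have E : theta j - theta i = theta (j - i).
  by rewrite /theta natrB 1?ltnW// -mulrBl -mulrBr.
under eq_bigr do rewrite -mulrBl -cosN -mulNr opprB E.
apply: (sum_cos_period (theta_period _)); rewrite gt_eqF// sin_gt0_pi//.
have -> : theta (j - i) / 2 = pi * ((j - i)%:R / n%:R) 
  by rewrite /theta; field; rewrite nat1r pnatr_eq0.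
rewrite mulr_gt0 ?pi_gt0 ?divr_gt0 ?ltr0n ?subn_gt0//=.
rewrite gtr_pMr ?pi_gt0// ltr_pdivrMr ?ltr0n// mul1r ltr_nat.
by rewrite (leq_ltn_trans (leq_subr _ _)).
Qed.

Lemma hartley_sqr : hartley *m hartley = n%:R%:M.
Proof.
apply/matrixP => i j; rewrite !mxE.
under eq_bigr do rewrite !mxE thetaC cas_mul.
rewrite big_split/= [X in _ + X = _](_ : _ = 0) ?addr0; last first.
  under eq_bigr do rewrite -mulrDl.
  apply: (@sum_sin_period _ (i + j)); rewrite mulrDl !theta_period -mulrnDr//.
have [<-|ij] := eqVneq i j.
  under eq_bigr do rewrite subrr cos0.
  by rewrite sumr_const card_ord mulr1n.
case: (ltngtP i j) => [lij|lij|/val_inj]; last by move/eqP; rewrite (negbTE ij).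
  by rewrite sum_cos ?lij/= ?mulr0n.
under eq_bigr do rewrite -cosN opprB.
by rewrite sum_cos ?lij/= ?mulr0n.
Qed.

(** Equal to [4 sin^2 (pi j / n)], the spectrum of the cyclic Laplacian; this form is what [casDB]
    produces. *)
Definition laplace_eig (j : 'I_n) : R := 2 - 2 * cos (theta j).

Lemma shift_tr_mul : shift_mx^T *m shift_mx = 1%:M.
Proof.
by apply/matrixP => i j; rewrite mul_shift_mx_tr !mxE ordSK eq_sym.
Qed.

Lemma shift_mul_tr : shift_mx *m shift_mx^T = 1%:M.
Proof.
by apply/matrixP => i j; rewrite mul_shift_mx !mxE (inj_eq (@ord_pred_inj _)).
Qed.

(** The left factor is the cyclic second difference [2 x_i - x_(i+1) - x_(i-1)]. [casDB] evaluates
    it on [cas], and periodicity takes care of the two wrapped indices. *)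
Lemma laplace_hartley :
  (1 - shift_mx)^T *m (1 - shift_mx) *m hartley =
  hartley *m diag_mx (\row_j laplace_eig j).
Proof.
rewrite [(1 - shift_mx)^T]raddfB/= trmx1 mulmxBr mulmx1 [_ *m shift_mx]mulmxBl mul1mx.
rewrite shift_tr_mul !mulmxBl mul1mx.
have -> : shift_mx *m hartley = \matrix_(i, j) hartley (ord_pred i) j.
  by apply/matrixP => i j; rewrite mul_shift_mx [RHS]mxE.
have -> : shift_mx^T *m hartley = \matrix_(i, j) hartley (ordS i) j.
  by apply/matrixP => i j; rewrite mul_shift_mx_tr [RHS]mxE.
apply/matrixP => i j; rewrite mul_mx_diag !mxE /= !cas_mod.
have -> : cas (theta j * (i + n).-1%:R) = cas (theta j * i%:R - theta j).
  rewrite addnS/= -(casD2pi (_ - _) j) -theta_period; congr cas.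
  by rewrite natrD -[n%:R in RHS]natr1; ring.
rewrite -[i.+1%:R]natr1 mulrDr mulr1 /laplace_eig.
by have := casDB (theta j * i%:R) (theta j); lra.
Qed.

(** The shift is orthogonal, so [1 - shift_mx] is normal and the Gram matrix of its power is the
    power of its Gram matrix. *)
Lemma sum_diff_row d :
  \sum_i (diff_row d i *m (diff_row d i)^T) = ((1 - shift_mx)^T *m (1 - shift_mx)) ^+ d.
Proof.
transitivity (((1 - shift_mx) ^+ d)^T *m (1 - shift_mx) ^+ d).
  apply/matrixP => a b; rewrite summxE !mxE; apply: eq_bigr => i _.
  by rewrite !mxE big_ord1 !mxE.
have X_tr k : ((1 - shift_mx) ^+ k)^T = (1 - shift_mx)^T ^+ k.
  by elim: k => [|k IHk]; rewrite ?expr0 ?trmx1// exprS exprSr -!mulmxE trmx_mul IHk.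
rewrite X_tr !mulmxE -exprMn_comm//.
rewrite /GRing.comm [(1 - shift_mx)^T]raddfB/= trmx1 -!mulmxE.
by rewrite !(mulmxBl, mulmxBr) !mul1mx !mulmx1 shift_tr_mul shift_mul_tr !opprB addrC.
Qed.

Lemma trace_gap_circulant (nu : R) d : 0 <= nu ->
  trace_gap (penalty_mx nu (diff_row d) 0) =
  \sum_(j < n) ((1 + nu * laplace_eig j ^+ d)^-1 - (1 + nu * laplace_eig j ^+ d)^-2).
Proof.
move=> nu0; set A := penalty_mx _ _ _.
have Au : A \in unitmx by exact/dominates1_unit/dominates1_penalty.
pose a (j : 'I_n) := 1 + nu * laplace_eig j ^+ d.
have a_neq0 j : a j != 0.
  rewrite gt_eqF// ltr_pwDl// mulr_ge0// exprn_ge0// /laplace_eig.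
  by have := cos_le1 (theta j); lra.
have AH : A *m hartley = hartley *m diag_mx (\row_j a j).
  rewrite /A /penalty_mx (eq_bigl xpredT)// sum_diff_row mulmxDl mul1mx -scalemxAl.
  have -> k : ((1 - shift_mx)^T *m (1 - shift_mx)) ^+ k *m hartley =
      hartley *m diag_mx (\row_j laplace_eig j ^+ k).
    elim: k => [|k IHk].
      rewrite expr0 mul1mx; apply/matrixP => i j.
      by rewrite mul_mx_diag !mxE expr0 mulr1.
    rewrite exprSr -mulmxE -mulmxA laplace_hartley mulmxA IHk -mulmxA.
    by apply/matrixP => i j; rewrite mulmxA !mul_mx_diag !mxE exprSr mulrA.
  apply/matrixP => i j; rewrite mul_mx_diag mxE [X in _ + X]mxE mul_mx_diag !mxE /a; ring.
pose D := diag_mx (\row_j (a j)^-1).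
have nV : n%:R^-1 * n%:R = 1 :> R by rewrite mulVf// pnatr_eq0.
have -> : trace_gap A = \tr D - \tr (D *m D).
  have iA : invmx A = n%:R^-1 *: (hartley *m D *m hartley).
    rewrite -[RHS](mulKmx Au) -[LHS]mulmx1; congr (_ *m _).
    rewrite -scalemxAr !mulmxA AH -(mulmxA hartley).
    have -> : diag_mx (\row_j a j) *m D = 1%:M.
      apply/matrixP => i j; rewrite /D mul_mx_diag !mxE.
      by case: eqVneq => [->|]; rewrite ?mulr1n ?mulfV// !mulr0n mul0r.
    by rewrite mulmx1 hartley_sqr scale_scalar_mx nV.
  rewrite /trace_gap iA -scalemxAl -scalemxAr; congr (_ - _).
    rewrite mxtraceZ mxtrace_mulC mulmxA hartley_sqr mul_scalar_mx mxtraceZ.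
    by rewrite mulrA nV mul1r.
  have -> : hartley *m D *m hartley *m (hartley *m D *m hartley) =
      n%:R *: (hartley *m (D *m D) *m hartley).
    rewrite -!mulmxA (mulmxA hartley hartley) hartley_sqr mul_scalar_mx.
    by rewrite -!scalemxAr.
  rewrite 2!scalerA -mulrA nV mulr1 mxtraceZ mxtrace_mulC mulmxA hartley_sqr.
  by rewrite mul_scalar_mx mxtraceZ mulrA nV mul1r.
rewrite /D; rewrite /mxtrace -sumrB; apply: eq_bigr => j _.
by rewrite mul_mx_diag !mxE eqxx mulr1n -invrM ?unitfE// expr2.
Qed.

End CyclicDifference.

(** * The Beta integral and the Riemann sum *)

Section BetaIntegral.
Context {R : realType}.
Local Notation mu := (@lebesgue_measure R).

Lemma integral_inv_sqrt_onem_lt (c b : R) : c < b -> b < 1 ->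
  (\int[mu]_(x in `[c, b]) ((Num.sqrt (1 - x))^-1)%:E
   = (2 * Num.sqrt (1 - c) - 2 * Num.sqrt (1 - b))%:E)%E.
Proof.
move=> cb b1; pose F (x : R) := - 2 * Num.sqrt (1 - x).
have dF (x : R) : x < 1 -> is_derive x 1 F (Num.sqrt (1 - x))^-1.
  move=> x1; have x1' : 0 < 1 - x by rewrite subr_gt0.
  have s1 : is_derive (1 - x) 1 Num.sqrt (2 * Num.sqrt (1 - x))^-1.
    exact: is_derive1_sqrt.
  have -> : F = (- 2) \*: (@Num.sqrt R \o (fun y => 1 - y)) by [].
  apply: is_derive_eq; rewrite /GRing.scale/= add0r mul1r mulrN1 mulrNN.
  by rewrite invfM mulrA mulfV ?mul1r.
have cF (x : R) : x < 1 -> {for x, continuous F}.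
  move=> x1; apply: differentiable_continuous; apply/derivable1_diffP.
  by have [] := dF x x1.
rewrite (@continuous_FTC2 _ _ F)//.
- by rewrite -EFinB /F; congr EFin; lra.
- apply: continuous_in_subspaceT => x; rewrite inE/= in_itv/= => /andP[_ xb].
  have x1 : 0 < 1 - x by rewrite subr_gt0 (le_lt_trans xb).
  apply: cvgV; first by rewrite gt_eqF// sqrtr_gt0.
  have h : 1 - y @[y --> x] --> 1 - x by apply: cvgB; [exact: cvg_cst|exact: cvg_id].
  exact: (cvg_comp _ _ h (@sqrt_continuous R (1 - x))).
- split.
  + move=> x; rewrite in_itv/= => /andP[_ xb].
    by have [] := dF x (lt_trans xb b1).
  + by apply: cvg_at_right_filter; apply: cF; exact: lt_trans b1.
  + by apply: cvg_at_left_filter; apply: cF.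
- move=> x; rewrite in_itv/= => /andP[_ xb].
  by rewrite derive1E; have ? := dF x (lt_trans xb b1); exact: derive_val.
Qed.

Lemma measurable_inv_sqrt_onem D :
  measurable_fun D (fun x : R => (Num.sqrt (1 - x))^-1).
Proof.
apply: (measurable_funS measurableT) => //.
(* For [x >= 1] both sides are 0, by the conventions for the square root of a negative number and
   for the inverse of 0. *)
have -> : (fun x : R => (Num.sqrt (1 - x))^-1) = fun x => (Num.max 0 (1 - x)) `^ (- 2^-1).
  apply/funext => x; rewrite powRN powR12_sqrt ?le_max ?lexx//.
  by case: leP => // x1; rewrite sqrtr0 ler0_sqrtr// ltW.
apply: (measurableT_comp (measurable_powR _)).
apply: measurable_maxr => //.
by apply: measurable_funB.
Qed.

Lemma measurable_EFin_inv_sqrt_onem D :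
  measurable_fun D (fun x : R => ((Num.sqrt (1 - x))^-1)%:E).
Proof. by apply/measurable_EFinP; exact: measurable_inv_sqrt_onem. Qed.

(** The integrand is unbounded near 1, so the primitive is used on [[c, b i]] with [b i < 1] and the
    limit is taken by monotone convergence. *)
Lemma integral_inv_sqrt_onem (c : R) : c < 1 ->
  (\int[mu]_(x in `[c, 1%R]) ((Num.sqrt (1 - x))^-1)%:E
   <= (2 * Num.sqrt (1 - c))%:E)%E.
Proof.
move=> c1; have mf := measurable_EFin_inv_sqrt_onem.
rewrite -integral_itv_bndo_bndc//.
(* The shift to [i.+2] makes [c < b i] strict already at [i = 0]. *)
pose b (i : nat) : R := 1 - (1 - c) / i.+2%:R.
have b1 i : b i < 1 by rewrite /b gtrBl divr_gt0// subr_gt0.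
have cb i : c < b i.
  rewrite /b ltrBrDl -ltrBrDr ltr_pdivrMr// ltr_pMr ?subr_gt0//.
  by rewrite ltr1n.
have bS i j : (i <= j)%N -> b i <= b j.
  move=> ij; rewrite /b lerB// ler_wpM2l//; first by rewrite subr_ge0 ltW.
  by rewrite lef_pV2 ?posrE// ler_nat.
have -> : `[c, 1[%classic = \bigcup_i `[c, b i]%classic.
  apply/seteqP; split=> [x/=|x [i _]]/=; rewrite !in_itv/= => /andP[cx].
    move=> x1; have [i] : exists i : nat, (1 - c) / (1 - x) < i%:R.
      exists (Num.truncn ((1 - c) / (1 - x))).+1; exact: truncnS_gt.
    move=> ix; exists i => //=; rewrite in_itv/= cx /b lerBrDl -lerBrDr.
    have x1' : 0 < 1 - x by rewrite subr_gt0.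
    rewrite ler_pdivrMr// mulrC -ler_pdivrMr// (le_trans (ltW ix))// ler_nat.
    by rewrite -addn2 leq_addr.
  by move=> xb; rewrite cx (le_lt_trans xb).
have cv : (\int[mu]_(x in `[c, b i]) ((Num.sqrt (1 - x))^-1)%:E)%E @[i --> \oo] -->
    (\int[mu]_(x in \bigcup_i `[c, b i]%classic) ((Num.sqrt (1 - x))^-1)%:E)%E.
  apply: ge0_nondecreasing_set_cvg_integral => //.
    move=> i j ij; apply/subsetPset => x/=; rewrite !in_itv/= => /andP[->/= xb].
    exact: le_trans (bS _ _ ij).
  by move=> i; exact: mf.
apply: cvge_le cv; apply: nearW => i.
rewrite integral_inv_sqrt_onem_lt// lee_fin gerBl.
by rewrite mulr_ge0// sqrtr_ge0.
Qed.


Section Quantile.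
Variable p : nat.
Hypothesis p2 : (2 <= p)%N.
Local Notation a := (p%:R^-1 : R).

(** The exponents are left unsimplified so that [Beta (1 + a) (1 - a)] unfolds to the integral of
    this function. *)
Definition beta_integrand (x : R) : R :=
  x `^ (1 + a - 1) * (1 - x) `^ (1 - a - 1).
Local Notation q := beta_integrand.

(** With [p = 2 * d], the factor by which the circulant smoother damps rescaled frequency [s]. *)
Definition transfer (s : R) : R := (1 + s ^+ p)^-1.
Local Notation h := transfer.

Let a_gt0 : 0 < a. Proof. by rewrite invr_gt0 ltr0n (leq_trans _ p2). Qed.

Let a_le : a <= 2^-1.
Proof. by rewrite lef_pV2 ?posrE ?ltr0n ?ler_nat// (leq_trans _ p2). Qed.

Lemma beta_integrandE x : q x = x `^ a * ((1 - x) `^ a)^-1.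
Proof. by rewrite /q -powRN addrAC subrr add0r addrAC subrr add0r. Qed.

Lemma beta_integrand_ge0 x : 0 <= q x.
Proof. by rewrite mulr_ge0 ?powR_ge0. Qed.

Lemma measurable_beta_integrand D : measurable_fun D q.
Proof.
apply: (measurable_funS measurableT) => //.
apply: measurable_funM; first exact: measurable_powR.
apply: (measurableT_comp (measurable_powR _)).
by apply: measurable_funB.
Qed.

Lemma measurable_EFin_beta_integrand D : measurable_fun D (EFin \o q).
Proof. by apply/measurable_EFinP; exact: measurable_beta_integrand. Qed.

(** Here [p >= 2] enters as [a <= 1 / 2]. The majorant has an explicit primitive and gives both
    integrability and the tail bound. At [x = 1] both sides are 0. *)
Lemma beta_integrand_le x : 0 <= x <= 1 -> q x <= (Num.sqrt (1 - x))^-1.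
Proof.
move=> /andP[x0]; rewrite le_eqVlt => /predU1P[->|x1].
  by rewrite beta_integrandE subrr sqrtr0 powR0 ?gt_eqF// invr0 mulr0.
have x1' : 0 < 1 - x by rewrite subr_gt0.
rewrite beta_integrandE -[leRHS]mul1r ler_pM ?powR_ge0 ?invr_ge0 ?powR_ge0//.
  have := @ge0_ler_powR _ a (ltW a_gt0) x 1; rewrite powR1; apply => //;
  rewrite ?nnegrE//; exact: ltW.
rewrite lef_pV2 ?posrE ?powR_gt0 ?sqrtr_gt0// -powR12_sqrt; last exact: ltW.
by apply: ger_powR => //; rewrite x1' gerBl.
Qed.

Lemma integrable_beta_integrand : mu.-integrable `[0, 1] (EFin \o q).
Proof.
apply/integrableP; split; first exact: measurable_EFin_beta_integrand.
apply: (@le_lt_trans _ _ (\int[mu]_(x in `[0%R, 1%R]) ((Num.sqrt (1 - x))^-1)%:E)%E).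
  under eq_integral do rewrite /= ger0_norm ?beta_integrand_ge0//.
  apply: ge0_le_integral => //=.
  - by move=> x _; rewrite lee_fin beta_integrand_ge0.
  - exact: measurable_EFin_beta_integrand.
  - exact: measurable_EFin_inv_sqrt_onem.
  - move=> x; rewrite in_itv/= => x01.
    by rewrite lee_fin beta_integrand_le.
by apply: le_lt_trans (integral_inv_sqrt_onem ltr01) _; rewrite ltry.
Qed.

Lemma transfer_gt0 s : 0 <= s -> 0 < h s.
Proof. by move=> s0; rewrite invr_gt0 ltr_pwDl// exprn_ge0. Qed.

Lemma transfer_le1 s : 0 <= s -> h s <= 1.
Proof. by move=> s0; rewrite invf_le1 ?lerDl ?exprn_ge0// ltr_pwDl// exprn_ge0. Qed.

Lemma transfer_anti s t : 0 <= s -> s <= t -> h t <= h s.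
Proof.
move=> s0 st; have t0 := le_trans s0 st.
rewrite lef_pV2 ?posrE ?ltr_pwDl ?exprn_ge0// lerD2l.
by rewrite lerXn2r ?nnegrE.
Qed.

Lemma transfer0 : h 0 = 1.
Proof. by rewrite /h expr0n gtn_eqF ?addr0 ?invr1// (leq_trans _ p2). Qed.

Lemma beta_integrand_transfer s : 0 <= s -> q (1 - h s) = s.
Proof.
move=> s0; have s1 : 0 < 1 + s ^+ p by rewrite ltr_pwDl// exprn_ge0.
have -> : 1 - h s = s ^+ p * h s by rewrite /h; field; rewrite gt_eqF.
rewrite beta_integrandE.
have -> : 1 - s ^+ p * h s = h s by rewrite /h; field; rewrite gt_eqF.
rewrite powRM ?exprn_ge0 ?(ltW (transfer_gt0 s0))// mulfK; last first.
  by rewrite gt_eqF// powR_gt0// transfer_gt0.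
rewrite -powR_mulrn// -powRrM mulfV ?powRr1//.
by rewrite gt_eqF// ltr0n (leq_trans _ p2).
Qed.

Lemma beta_integrand_homo x y : 0 <= x -> x <= y -> y < 1 -> q x <= q y.
Proof.
move=> x0 xy y1; rewrite !beta_integrandE.
have x1' : 0 < 1 - x by lra.
have y1' : 0 < 1 - y by lra.
rewrite ler_pM ?powR_ge0 ?invr_ge0 ?powR_ge0//.
  by rewrite ge0_ler_powR ?nnegrE ?(ltW a_gt0)// (le_trans x0).
rewrite lef_pV2 ?posrE ?powR_gt0//.
by rewrite ge0_ler_powR ?nnegrE ?(ltW a_gt0)//; lra.
Qed.

(** Under [x = 1 - h u] this is [p] times the integral of [u^p / (1 + u^p)^2] over [[0, s]]; staying
    in the variable [x] avoids proving that. *)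
Definition partial_beta (s : R) : R := \int[mu]_(x in `[0, 1 - h s]) q x.

Let sub01 s : 0 <= s -> `[0, 1 - h s]%classic `<=` `[0, 1]%classic.
Proof.
move=> s0 x /=; rewrite !in_itv/= => /andP[->/= /le_trans]; apply.
by rewrite gerBl ltW// transfer_gt0.
Qed.

(* [beta_integrand] is the increasing inverse of [fun s => 1 - transfer s], so it
   lies between [s] and [t] on the interval from [1 - h s] to [1 - h t]. *)
Lemma partial_beta_bounds s t : 0 <= s -> s <= t ->
  s * (h s - h t) <= partial_beta t - partial_beta s <= t * (h s - h t).
Proof.
move=> s0 st; have t0 := le_trans s0 st.
have hst := transfer_anti s0 st; have ht := transfer_gt0 t0; have hs := transfer_le1 s0.
have It : mu.-integrable `[0, 1 - h t] (EFin \o q).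
  by apply: integrableS integrable_beta_integrand => //; exact: sub01.
have Iq : mu.-integrable `]1 - h s, 1 - h t] (EFin \o q).
  apply: integrableS It => //.
  by apply: subset_itvr; rewrite bnd_simp; lra.
have mst : mu `]1 - h s, 1 - h t] = (h s - h t)%:E.
  rewrite lebesgue_measure_itv/= lte_fin; case: ifPn => [_|].
    by rewrite -EFinB; congr EFin; lra.
  by rewrite -leNgt => ?; congr EFin; lra.
rewrite /partial_beta Rintegral_itvB//; last 2 first.
- by rewrite bnd_simp; lra.
- by rewrite bnd_simp; lra.
have Ic (c : R) : mu.-integrable `]1 - h s, 1 - h t] (EFin \o cst c).
  apply: measurable_bounded_integrable => //=; last exact: bounded_cst.
  by rewrite [X in (X < _)%E]mst ltry.
have Rc (c : R) : \int[mu]_(x in `]1 - h s, 1 - h t]) c = c * (h s - h t).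
  by rewrite Rintegral_cst// [X in fine X]mst.
rewrite -!Rc; apply/andP; split.
  apply: le_Rintegral => //; first exact: Ic.
  move=> x; rewrite /= in_itv/= => /andP[x1 x2].
  by rewrite -[leLHS](beta_integrand_transfer s0) beta_integrand_homo//; lra.
apply: le_Rintegral => //; first exact: Ic.
move=> x; rewrite /= in_itv/= => /andP[x1 x2].
by rewrite -[leRHS](beta_integrand_transfer t0) beta_integrand_homo//; lra.
Qed.

Lemma partial_beta0 : partial_beta 0 = 0.
Proof. by rewrite /partial_beta transfer0 subrr set_itv1 Rintegral_set1. Qed.

(** The tail is at most the integral of [(1 - x)^(-1/2)] from [1 - h s] to 1, that is
    [2 sqrt (h s)], and [h s <= s^-p <= s^-2]. *)
Lemma Beta_partial_beta s : 1 <= s -> 0 <= Beta (1 + a) (1 - a) - partial_beta s <= 2 / s.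
Proof.
move=> s1; have s0 : 0 <= s by lra.
have h0 := transfer_gt0 s0; have h1 := transfer_le1 s0.
rewrite /partial_beta /Beta -/q Rintegral_itvB ?bnd_simp; last 3 first.
- exact: integrable_beta_integrand.
- by lra.
- by lra.
have Iq : mu.-integrable `]1 - h s, 1] (EFin \o q).
  apply: integrableS integrable_beta_integrand => //.
  by apply: subset_itvr; rewrite bnd_simp; lra.
rewrite Rintegral_ge0/=; last by move=> *; exact: beta_integrand_ge0.
rewrite -lee_fin /Rintegral fineK; last exact: integrable_fin_num.
rewrite integral_itv_obnd_cbnd; last exact: measurable_EFin_beta_integrand.
have hs : Num.sqrt (h s) <= s^-1.
  rewrite -[leRHS]ger0_norm ?invr_ge0// -sqrtr_sqr ler_wsqrtr//.
  rewrite exprVn lef_pV2 ?posrE ?ltr_pwDl ?exprn_ge0 ?exprn_gt0//; last lra.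
  rewrite (@le_trans _ _ (s ^+ p))//; last lra.
  by rewrite ler_weXn2l.
apply: (@le_trans _ _ (2 * Num.sqrt (1 - (1 - h s)))%:E); last first.
  by rewrite lee_fin subKr ler_wpM2l.
apply: le_trans (integral_inv_sqrt_onem _); last lra.
apply: ge0_le_integral => //=.
- by move=> x _; rewrite lee_fin beta_integrand_ge0.
- exact: measurable_EFin_beta_integrand.
- exact: measurable_EFin_inv_sqrt_onem.
- move=> x; rewrite in_itv/= => /andP[x0 x1].
  by rewrite lee_fin beta_integrand_le//; lra.
Qed.

(** The slice between [s = 1] and [s = 2] alone contributes at least [h 1 - h 2 >= 1/2 - 1/3].
    Positivity allows division by the leading constant. *)
Lemma Beta_gt0 : 0 < Beta (1 + a) (1 - a).
Proof.
have /andP[B2 _] := Beta_partial_beta (ler1n R 2).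
have /andP[J12 _] := partial_beta_bounds ler01 (ler1n R 2).
have J1 : 0 <= partial_beta 1 by apply: Rintegral_ge0 => x _; exact: beta_integrand_ge0.
have h1 : h 1 = 2^-1 by rewrite /h expr1n.
have h2 : h 2 <= 3^-1.
  rewrite lef_pV2 ?posrE ?ltr_pwDl ?exprn_ge0//.
  have : 2 <= 2 ^+ p :> R by rewrite -[leLHS]expr1 ler_weXn2l ?ler1n// ltnW.
  lra.
lra.
Qed.

End Quantile.

End BetaIntegral.

(** * Comparison of the sum over the sine nodes with the Beta integral *)

Lemma leq_half_mul4 n : (2 <= n)%N -> (n <= n./2 * 4)%N.
Proof. lia. Qed.

Section RiemannSum.
Context {R : realType}.
Variables (p n : nat) (z : R).
Hypotheses (p2 : (2 <= p)%N) (n0 : (0 < n)%N) (z1 : 1 <= z).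

(** The [p]-th power at an integer [j] is [nu * laplace_eig j ^+ d] when [p = 2 * d] and [z^p = nu].
    The argument is real because the mean value theorem is applied between integers. *)
Definition node (y : R) : R := 2 * z * sin (pi * y / n%:R).
Local Notation S := node.
Local Notation h := (transfer p).
Local Notation J := (partial_beta p).
(** The derivative of [node] at 0 and an upper bound for it elsewhere, hence for the spacing of
    consecutive nodes. *)
Let kappa : R := 2 * pi * z / n%:R.

Let n_gt0 : 0 < n%:R :> R. Proof. by rewrite ltr0n. Qed.
Let z_gt0 : 0 < z. Proof. exact: lt_le_trans z1. Qed.
Let kappa_gt0 : 0 < kappa.
Proof. by rewrite divr_gt0// !mulr_gt0// pi_gt0. Qed.

Let angle (y : R) : 0 <= y -> y <= n%:R / 2 -> 0 <= pi * y / n%:R <= pi / 2.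
Proof.
move=> y0 yn; rewrite divr_ge0 ?mulr_ge0 ?pi_ge0 ?(ltW n_gt0)//= ler_pdivrMr//.
by rewrite mulrAC -mulrA ler_wpM2l ?pi_ge0.
Qed.

Let node_ge0 y : 0 <= y -> y <= n%:R / 2 -> 0 <= S y.
Proof.
move=> y0 yn; have /andP[a0 a1] := angle y0 yn.
rewrite mulr_ge0 ?mulr_ge0 ?(ltW z_gt0)// sin_ge0_pi// a0 (le_trans a1)//.
by have := pi_gt0 R; lra.
Qed.

Let node_derive (y : R) : is_derive y 1 S (kappa * cos (pi * y / n%:R)).
Proof.
have lin : is_derive y 1 (fun x : R => pi * x / n%:R) (pi / n%:R).
  have -> : (fun x : R => pi * x / n%:R) = (pi / n%:R) \*: (@id R).
    by apply/funext => x; rewrite /GRing.scale/= mulrAC.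
  by apply: is_derive_eq; rewrite /GRing.scale/= mulr1.
have -> : S = (2 * z) \*: (@sin R \o (fun x => pi * x / n%:R)) by [].
apply: is_derive_eq; rewrite /GRing.scale/= /kappa; ring.
Qed.

Let hnode_derive (y : R) : 0 <= y -> y <= n%:R / 2 ->
  is_derive y 1 (fun x => h (S x))
    (- (p%:R * S y ^+ p.-1 * h (S y) ^+ 2) * (kappa * cos (pi * y / n%:R))).
Proof.
move=> y0 yn; have s0 := node_ge0 y0 yn.
have d1 : is_derive (S y) 1 h (- (p%:R * S y ^+ p.-1 * h (S y) ^+ 2)).
  have den : 1 + S y ^+ p != 0 by rewrite gt_eqF// ltr_pwDl// exprn_ge0.
  have dp : is_derive (S y) 1 (fun s : R => 1 + s ^+ p) (p%:R * S y ^+ p.-1).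
    have -> : (fun s : R => 1 + s ^+ p) = cst 1 + (@id R) ^+ p.
      by apply/funext => s; rewrite [RHS]/GRing.add/= exprfctE.
    by apply: is_derive_eq; rewrite /GRing.scale/= add0r mulr1.
  have := @is_deriveV _ (fun s : R => 1 + s ^+ p) _ _ _ den dp.
  move=> dV; apply: (is_derive_eq dV).
  by rewrite /transfer /GRing.scale/= exprVn; ring.
have := node_derive y => dS.
have -> : (fun x => h (S x)) = h \o S by [].
by apply: is_derive_eq.
Qed.

Let mvt (y : R) : 0 <= y -> y + 1 <= n%:R / 2 ->
  exists2 xi, y <= xi <= y + 1 &
    h (S y) - h (S (y + 1)) =
      p%:R * S xi ^+ p.-1 * h (S xi) ^+ 2 * (kappa * cos (pi * xi / n%:R)).
Proof.
move=> y0 yn; pose f x := h (S x).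
have df x : x \in `[y, y + 1] -> is_derive x 1 f
    (- (p%:R * S x ^+ p.-1 * h (S x) ^+ 2) * (kappa * cos (pi * x / n%:R))).
  by rewrite in_itv/= => /andP[yx xy]; apply: hnode_derive; lra.
have yy : y <= y + 1 by rewrite lerDl.
have cf : {within `[y, y + 1], continuous f}.
  by apply: derivable_within_continuous => x /df [].
have [xi] := MVT_segment yy (fun x xy => df x (subset_itv_oo_cc xy)) cf.
rewrite in_itv/= addrAC subrr add0r mulr1 => yxi E; exists xi => //.
by rewrite -opprB; move: E; rewrite /f => ->; ring.
Qed.

Let node_lip (x y : R) : x <= y -> S y - S x <= kappa * (y - x).
Proof.
move=> xy; have cS : {within `[x, y], continuous S}.
  by apply: derivable_within_continuous => t _; have [] := node_derive t.
have [xi _ ->] := MVT_segment xy (fun t _ => node_derive t) cS.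
by rewrite ler_wpM2r ?subr_ge0// -[leRHS]mulr1 ler_wpM2l ?(ltW kappa_gt0)//.
Qed.

Let node_homo (x y : R) : 0 <= x -> x <= y -> y <= n%:R / 2 -> S x <= S y.
Proof.
move=> x0 xy yn; have cS : {within `[x, y], continuous S}.
  by apply: derivable_within_continuous => t _; have [] := node_derive t.
have [xi] := MVT_segment xy (fun t _ => node_derive t) cS.
rewrite in_itv/= => /andP[x1 x2] E; rewrite -subr_ge0 E mulr_ge0 ?subr_ge0//.
rewrite mulr_ge0 ?(ltW kappa_gt0)// cos_ge0_pihalf//.
have /andP[a0 ->] := angle (le_trans x0 x1) (le_trans x2 yn).
by rewrite andbT (le_trans _ a0)// oppr_le0 divr_ge0// pi_ge0.
Qed.

Definition bias_weight (s : R) : R := h s - h s ^+ 2.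

Let bias_weightE s : 0 <= s -> bias_weight s = s ^+ p * h s ^+ 2.
Proof.
move=> s0; rewrite /bias_weight /transfer; field.
by rewrite gt_eqF// ltr_pwDl// exprn_ge0.
Qed.

(** Compare [s^(p+2)] with [s^p] if [s <= 1] and with [s^(2p)] otherwise. The decay [s^-2] absorbs
    the factor [sin^2], which is [s^2 / (4 z^2)] at a node. *)
Let bias_weight_sqr_le s : 0 <= s -> bias_weight s * s ^+ 2 <= 1.
Proof.
move=> s0; have sp0 : 0 <= s ^+ p by rewrite exprn_ge0.
have s1 : 0 < 1 + s ^+ p by rewrite ltr_pwDl.
rewrite bias_weightE// /transfer exprVn mulrAC ler_pdivrMr ?exprn_gt0// mul1r.
have [sle|/ltW sge] := leP s 1.
  have s2 : s ^+ 2 <= 1 by rewrite exprn_ile1.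
  have := ler_wpM2l sp0 s2; have := sqr_ge0 (s ^+ p); lra.
have s2 : s ^+ 2 <= s ^+ p by rewrite ler_weXn2l.
by have := ler_wpM2l sp0 s2; lra.
Qed.

(* Compare both terms with the value at the mean value point [xi]: the factor
   [cos] costs at most [(4 z^2)^-1], since [1 - cos <= sin^2], and everything else
   is controlled by the decrement of [h], which telescopes. *)
Let riemann_step (y : R) : 0 <= y -> y + 1 <= n%:R / 2 ->
  `|J (S (y + 1)) - J (S y) - p%:R * kappa * bias_weight (S y)| <=
  kappa * (1 + 3 * p%:R) * (h (S y) - h (S (y + 1))) + p%:R * kappa / (4 * z ^+ 2).
Proof.
move=> y0 yn; have [xi /andP[yx xy] D] := mvt y0 yn.
have yn' : y <= n%:R / 2 by lra.
have xi0 := le_trans y0 yx; have xin := le_trans xy yn.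
have y1 : 0 <= y + 1 by lra.
have S01 : S y <= S xi by exact: node_homo.
have S12 : S xi <= S (y + 1) by exact: node_homo.
have S02 : S (y + 1) - S y <= kappa.
  by apply: le_trans (node_lip _) _; rewrite ?lerDl// addrAC subrr add0r mulr1.
have s0 := node_ge0 y0 yn'; have s1 := node_ge0 xi0 xin; have s2 := node_ge0 y1 yn.
have /andP[J1 J2] := partial_beta_bounds p2 s0 (le_trans S01 S12).
set d := h (S y) - h (S (y + 1)) in D J1 J2 *.
set c := cos _ in D.
have h01 : h (S xi) <= h (S y) by exact: transfer_anti.
have h12 : h (S (y + 1)) <= h (S xi) by exact: transfer_anti.
have h0 : h (S y) <= 1 by exact: transfer_le1.
have h2 : 0 < h (S (y + 1)) by exact: transfer_gt0.
have d0 : 0 <= d by rewrite /d; lra.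
(* The mean value form of [s |h'(s)| = p * bias_weight s]: a slice of the Beta integral becomes a
   term of the sum, up to the cosine. *)
have sD : S xi * d = p%:R * kappa * c * bias_weight (S xi).
  have sp : S xi ^+ p = S xi * S xi ^+ p.-1 by rewrite -exprS (ltn_predK p2).
  by rewrite bias_weightE// D sp; ring.
have /andP[c0 c1] : 0 <= c <= 1.
  rewrite cos_le1 andbT cos_ge0_pihalf//.
  have /andP[a0 ->] := angle xi0 xin.
  by rewrite andbT (le_trans _ a0)// oppr_le0 divr_ge0// pi_ge0.
have g0 : 0 <= bias_weight (S xi) by rewrite bias_weightE// mulr_ge0 ?sqr_ge0 ?exprn_ge0.
have gc : bias_weight (S xi) * (1 - c) <= (4 * z ^+ 2)^-1.
  have z2 : 0 < 4 * z ^+ 2 by rewrite mulr_gt0 ?exprn_gt0.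
  rewrite -div1r ler_pdivlMr// (le_trans _ (bias_weight_sqr_le s1))//.
  rewrite -mulrA ler_wpM2l// /node !exprMn sin2cos2 -/c.
  have -> : 2 ^+ 2 * z ^+ 2 * (1 - c ^+ 2) = (1 - c) * (4 * z ^+ 2) * (1 + c) by ring.
  have z0 := ltW z_gt0.
  by rewrite ler_peMr ?mulr_ge0 ?(ltW z2)//; lra.
have gd : `|bias_weight (S xi) - bias_weight (S y)| <= 3 * d.
  have k1 : 0 <= h (S y) - h (S xi) <= d by rewrite /d; lra.
  have k2 : 0 <= h (S y) + h (S xi) <= 2 by lra.
  have -> : bias_weight (S xi) - bias_weight (S y) =
    (h (S y) - h (S xi)) * (h (S y) + h (S xi)) - (h (S y) - h (S xi)).
    by rewrite /bias_weight; ring.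
  have /andP[k10 k11] := k1; have /andP[k20 k22] := k2.
  have := mulr_ge0 k10 k20; have := ler_wpM2l k10 k22.
  by rewrite ler_norml; lra.
have Jd : `|J (S (y + 1)) - J (S y) - S xi * d| <= kappa * d.
  have := ler_wpM2r d0 S01; have := ler_wpM2r d0 S12; have := ler_wpM2r d0 S02.
  by rewrite ler_norml; lra.
have pk : 0 <= p%:R * kappa by rewrite mulr_ge0// ltW.
have -> : J (S (y + 1)) - J (S y) - p%:R * kappa * bias_weight (S y) =
   (J (S (y + 1)) - J (S y) - S xi * d) - p%:R * kappa * (bias_weight (S xi) * (1 - c))
   + p%:R * kappa * (bias_weight (S xi) - bias_weight (S y)) by rewrite sD; ring.
have gc0 : 0 <= bias_weight (S xi) * (1 - c) by rewrite mulr_ge0// subr_ge0.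
apply: le_trans (ler_normD _ _) _; rewrite normrM (ger0_norm pk).
have := ler_wpM2l pk gd => {}gd.
apply: le_trans (lerD (ler_normB _ _) gd) _.
rewrite (ger0_norm (mulr_ge0 pk gc0)).
have := ler_wpM2l pk gc => {}gc; move: Jd gc; lra.
Qed.

Lemma riemann_half (K : nat) : K%:R <= n%:R / 2 :> R ->
  `|J (S K%:R) - p%:R * kappa * \sum_(j < K) bias_weight (S j%:R)| <=
  kappa * (1 + 3 * p%:R) + K%:R * (p%:R * kappa / (4 * z ^+ 2)).
Proof.
move=> Kn.
(* Keeping the telescoped total [1 - h (S K)] makes the induction go through; afterwards it is
   bounded by 1. *)
suff : `|J (S K%:R) - p%:R * kappa * \sum_(j < K) bias_weight (S j%:R)| <=
  kappa * (1 + 3 * p%:R) * (1 - h (S K%:R)) + K%:R * (p%:R * kappa / (4 * z ^+ 2)).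
  move=> /le_trans; apply; rewrite lerD2r -[leRHS]mulr1 ler_wpM2l//.
    by rewrite mulr_ge0 ?(ltW kappa_gt0)// addr_ge0// mulr_ge0.
  by rewrite gerBl ltW// transfer_gt0// node_ge0.
elim: K Kn => [_|K IHK Kn].
  rewrite big_ord0 mulr0 mul0r addr0 subr0 /node mulr0 mul0r sin0 mulr0.
  by rewrite partial_beta0// transfer0// subrr mulr0 normr0.
have Kn' : K%:R <= n%:R / 2 :> R by apply: le_trans Kn; rewrite ler_nat.
have K0 : 0 <= K%:R :> R by [].
have K1 : K%:R + 1 <= n%:R / 2 :> R by rewrite natr1.
have := riemann_step K0 K1; rewrite natr1 => st.
have {}IHK := IHK Kn'; rewrite big_ord_recr/= mulrDr.
have -> : J (S K.+1%:R) - (p%:R * kappa * (\sum_(i < K) bias_weight (S i%:R))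
    + p%:R * kappa * bias_weight (S K%:R)) =
  (J (S K%:R) - p%:R * kappa * (\sum_(i < K) bias_weight (S i%:R))) +
  (J (S K.+1%:R) - J (S K%:R) - p%:R * kappa * bias_weight (S K%:R)) by ring.
apply: le_trans (ler_normD _ _) _; apply: le_trans (lerD IHK st) _.
by rewrite -[K.+1%:R]natr1; lra.
Qed.

Let bias_weight_ge0 s : 0 <= s -> 0 <= bias_weight s.
Proof. by move=> s0; rewrite bias_weightE// mulr_ge0 ?sqr_ge0 ?exprn_ge0. Qed.

Let bias_weight_le s : bias_weight s <= 4^-1.
Proof. by have := sqr_ge0 (h s - 2^-1); rewrite /bias_weight; lra. Qed.

Let node_sym (j : nat) : (j <= n)%N -> S (n - j)%:R = S j%:R.
Proof.
move=> jn; rewrite /node natrB// mulrBr mulrBl mulfK ?gt_eqF//.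
by rewrite sinB sinpi cospi mul0r sub0r mulN1r opprK.
Qed.

Let node_nat_ge0 (j : nat) : (j <= n)%N -> 0 <= S j%:R.
Proof.
move=> jn; rewrite mulr_ge0 ?mulr_ge0 ?(ltW z_gt0)// sin_ge0_pi//.
rewrite divr_ge0 ?mulr_ge0 ?pi_ge0//= ler_pdivrMr// ler_wpM2l ?pi_ge0//.
by rewrite ler_nat.
Qed.

(** Nodes [j] and [n - j] coincide, which reduces the sum to the range where [node] increases. At
    most two terms remain unpaired, each at most 1/4, and the term at 0 vanishes. *)
Let sum_symmetric : (2 <= n)%N ->
  `|\sum_(j < n) bias_weight (S j%:R) - 2 * \sum_(j < n./2) bias_weight (S j%:R)| <= 1.
Proof.
move=> n2; have Kn : (n./2 <= n)%N by rewrite -divn2 leq_div.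
rewrite -(big_mkord xpredT (fun j => bias_weight (S j%:R))) (@big_cat_nat _ _ _ n./2)//=.
rewrite -(big_mkord xpredT (fun j => bias_weight (S j%:R))).
set T := \sum_(0 <= j < n./2) _.
have -> : \sum_(n./2 <= j < n) bias_weight (S j%:R) =
    \sum_(0 <= j < n - n./2) bias_weight (S j.+1%:R).
  transitivity (\sum_(n./2 <= j < n) bias_weight (S (n - j)%:R)).
    by apply: eq_big_nat => j /andP[_ /ltnW jn]; rewrite node_sym.
  rewrite big_nat_rev/= -{1}[n./2]add0n big_addn; apply: eq_big_nat => j jK.
  congr (bias_weight (S _%:R)); lia.
have T1 : \sum_(0 <= j < n./2) bias_weight (S j.+1%:R) =
    T - bias_weight (S 0) + bias_weight (S n./2%:R).
  have := telescope_sumr (fun j => bias_weight (S j%:R)) (leq0n n./2).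
  rewrite sumrB -/T; lra.
have S0 : bias_weight (S 0) = 0.
  by rewrite /node mulr0 mul0r sin0 mulr0 /bias_weight transfer0// expr1n subrr.
have g1 := bias_weight_ge0 (node_nat_ge0 Kn); have g2 := bias_weight_le (S n./2%:R).
have nK : (n - n./2 = n./2 + odd n)%N by lia.
rewrite nK; case: (odd n) nK => nK; last by rewrite addn0 T1 S0 ler_norml; lra.
have Kn' : (n./2.+1 <= n)%N by lia.
have g3 := bias_weight_ge0 (node_nat_ge0 Kn'); have g4 := bias_weight_le (S n./2.+1%:R).
by rewrite addn1 big_nat_recr//= T1 S0 ler_norml; lra.
Qed.

(** Doubling the half sum turns [B / (p * kappa)] into the main term. The 8 is 1 for symmetry plus
    twice [(1 + 3 p) / p <= 7/2]; the Beta tail and the cosine factor each cost at most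
    [n / z^2]. *)
Lemma riemann_sum : (2 <= n)%N ->
  `|\sum_(j < n) bias_weight (S j%:R)
    - n%:R / z * (Beta (1 + p%:R^-1) (1 - p%:R^-1) / (p%:R * pi))|
  <= 8 + 2 * (n%:R / z ^+ 2).
Proof.
move=> n2; set B := Beta _ _; pose K := n./2.
have nn0 : n%:R != 0 :> R by rewrite gt_eqF.
have pn0 : p%:R != 0 :> R by rewrite gt_eqF// ltr0n (leq_trans _ p2).
have zn0 : z != 0 by rewrite gt_eqF.
have kn0 : kappa != 0 by rewrite gt_eqF.
have Kn : K%:R <= n%:R / 2 :> R.
  by rewrite ler_pdivlMr// -natrM ler_nat muln2 halfK leq_subr.
have Kn3 : n%:R / 4 <= K%:R :> R.
  by rewrite ler_pdivrMr// -natrM ler_nat leq_half_mul4.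
(* The angle at [K] lies in [[pi / 4, pi / 2]], so its sine is at least 1/2; the Beta tail beyond
   the last node is thus at most [2 / z]. *)
have sK : z <= S K%:R.
  have [a0 a1] := andP (angle (ler0n _ K) Kn).
  have a2 : pi / 4 <= pi * K%:R / n%:R :> R.
    by rewrite -mulrA ler_wpM2l ?pi_ge0// ler_pdivlMr// mulrC.
  set x := pi * K%:R / n%:R in a0 a1 a2 *.
  have s0 : 0 <= sin x by rewrite sin_ge0_pi// a0 (le_trans a1)//; have := pi_gt0 R; lra.
  have c0 : cos (x *+ 2) <= 0.
    rewrite -(subrK (pi / 2) (x *+ 2)) cosDpihalf oppr_le0 sin_ge0_pi//.
    by apply/andP; split; have := pi_gt0 R; lra.
  have s1 : 2^-1 <= sin x by move: c0; rewrite cos_mulr2n cos2sin2; nra.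
  rewrite /node -/x mulrAC ler_peMl ?(ltW z_gt0)//; lra.
have half := riemann_half Kn.
have /andP[t0 t1] := Beta_partial_beta p2 (le_trans z1 sK).
set T := \sum_(j < K) _ in half.
set F := \sum_(j < n) _.
have FT : `|F - 2 * T| <= 1 by exact: sum_symmetric.
have t2 : 2 / S K%:R <= 2 / z by rewrite ler_wpM2l// lef_pV2 ?posrE// (lt_le_trans z_gt0).
have pk : 0 < p%:R * kappa by rewrite mulr_gt0// ltr0n (leq_trans _ p2).
have key : `|T - B / (p%:R * kappa)| <=
   2 / z / (p%:R * kappa) + (1 + 3 * p%:R) / p%:R + K%:R / (4 * z ^+ 2).
  have : `|p%:R * kappa * T - B| <=
      2 / z + (kappa * (1 + 3 * p%:R) + K%:R * (p%:R * kappa / (4 * z ^+ 2))).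
    by rewrite -/B in t0 t1; move: half t0 t1 t2; rewrite !ler_norml; lra.
  have -> : p%:R * kappa * T - B = p%:R * kappa * (T - B / (p%:R * kappa)).
    by field; rewrite !gt_eqF// ltr0n (leq_trans _ p2).
  rewrite normrM (gtr0_norm pk) mulrC -ler_pdivlMr// => /le_trans; apply.
  rewrite le_eqVlt; apply/orP; left; apply/eqP; field.
  by rewrite !gt_eqF// ltr0n (leq_trans _ p2).
have p_ge2 : 2 <= p%:R :> R by rewrite ler_nat.
have E1 : 2 * (B / (p%:R * kappa)) = n%:R / z * (B / (p%:R * pi)).
  rewrite /kappa; have : pi != 0 :> R by rewrite gt_eqF// pi_gt0.
  by move: (pi : R) => c c0; field; rewrite ?nn0 ?pn0 ?zn0 ?c0.
have E2 : 2 * (2 / z / (p%:R * kappa)) <= n%:R / z ^+ 2.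
  have -> : 2 * (2 / z / (p%:R * kappa)) = 2 / (p%:R * pi) * (n%:R / z ^+ 2).
    rewrite /kappa; have : pi != 0 :> R by rewrite gt_eqF// pi_gt0.
    by move: (pi : R) => c c0; field; rewrite ?nn0 ?pn0 ?zn0 ?c0.
  rewrite ler_piMl ?divr_ge0 ?exprn_ge0 ?(ltW z_gt0)//.
  rewrite ler_pdivrMr ?mul1r ?mulr_gt0 ?pi_gt0 ?ltr0n ?(leq_trans _ p2)//.
  by rewrite -[leLHS]mulr1 ler_pM// (le_trans _ (pi_ge2 R))// ler1n.
have E3 : (1 + 3 * p%:R) / p%:R <= 7/2 :> R.
  by rewrite ler_pdivrMr; lra.
have E4 : K%:R / (4 * z ^+ 2) <= n%:R / z ^+ 2 / 2.
  have z2 : 0 < (z ^+ 2)^-1 by rewrite invr_gt0 exprn_gt0.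
  rewrite invfM; have := ler_wpM2r (ltW z2) Kn.
  have : 0 <= n%:R * (z ^+ 2)^-1 by rewrite mulr_ge0 ?(ltW z2).
  lra.
rewrite -E1; move: FT key E2 E3 E4; rewrite !ler_norml; lra.
Qed.

End RiemannSum.

Lemma trace_gap_asymp (R : realType) (d m : nat) (nu z : R) :
  (1 <= d)%N -> (d <= m)%N -> 1 <= z -> nu = z ^+ (2 * d) ->
  `|trace_gap (penalty_mx nu (@diff_row R m d) d)
    - m.+1%:R / z * (Beta (1 + (2 * d)%:R^-1) (1 - (2 * d)%:R^-1) / ((2 * d)%:R * pi))|
  <= (2 * d)%:R + 8 + 2 * (m.+1%:R / z ^+ 2).
Proof.
move=> d1 dm z1 nuE; have nu0 : 0 <= nu by rewrite nuE exprn_ge0//; lra.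
have p2 : (2 <= 2 * d)%N by rewrite -[X in (X <= _)%N]muln1 leq_mul2l.
have := trace_gap_penalty (@diff_row R m d) nu0 (leqW dm).
rewrite trace_gap_circulant//.
rewrite (eq_bigr (fun j : 'I_m.+1 => bias_weight (2 * d) (node m.+1 z j%:R))); last first.
  move=> j _; rewrite /bias_weight /transfer exprVn; suff -> : nu * laplace_eig j ^+ d =
    node m.+1 z j%:R ^+ (2 * d) by [].
  rewrite nuE /laplace_eig /node !exprM -exprMn; congr (_ ^+ d).
  have -> : (pi *+ 2) * j%:R / m.+1%:R = (pi * j%:R / m.+1%:R) *+ 2 :> R.
    by rewrite !mulrnAl.
  by rewrite !exprMn cos_mulr2n cos2sin2 -mulr_natl; ring.
have m1 : (1 < m.+1)%N by rewrite ltnS (leq_trans d1).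
have := riemann_sum p2 (ltn0Sn m) z1 m1.
set X := Beta _ _ / _; set F := \sum_(j < _) _.
rewrite !ler_norml; lra.
Qed.

(** * Independence and conditional expectation *)

Section Independence.
Context {disp : measure_display} {T : measurableType disp} {R : realType}.
Variable P : probability T R.
Local Open Scope ereal_scope.

(** The joint law agrees with the product law on rectangles, hence everywhere, and Fubini factors
    the integral. *)
Lemma expectation_indepM (X Y : {RV P >-> R}) :
  (forall A B : set R, measurable A -> measurable B ->
    P (X @^-1` A `&` Y @^-1` B) = P (X @^-1` A) * P (Y @^-1` B)) ->
  P.-integrable setT (EFin \o X) -> P.-integrable setT (EFin \o Y) ->
  P.-integrable setT (fun w => (X w * Y w)%:E) ->
  \int[P]_w (X w * Y w)%:E = (\int[P]_w (X w)%:E) * (\int[P]_w (Y w)%:E).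
Proof.
move=> XY iX iY iXY.
pose f (z : R * R) : \bar R := (z.1 * z.2)%:E.
have mphi : measurable_fun setT (fun w => (X w, Y w)) by exact: measurable_fun_pair.
pose phi : {mfun T >-> (R * R)%type} :=
  HB.pack (fun w => (X w, Y w)) (isMeasurableFun.Build _ _ _ _ _ mphi).
have mf : measurable_fun setT f by apply/measurable_EFinP; exact: measurable_funM.
pose m1 := distribution P X; pose m2 := distribution P Y.
pose m' := distribution P phi.
have mE S : measurable S -> (m1 \x m2) S = m' S.
  by apply: product_measure_unique => A B mA mB; rewrite -XY.
have if' : (m1 \x m2).-integrable setT f.
  apply/integrableP; split=> //.
  rewrite (@eq_measure_integral _ _ _ _ m'); last by move=> S mS _; exact: mE.
  by have /integrableP[] : m'.-integrable setT f by apply: integrable_pushforward.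
transitivity (\int[m']_z f z); first by rewrite integral_pushforward.
rewrite -(@eq_measure_integral _ _ _ _ m' (m1 \x m2)); last by move=> S mS _; exact: mE.
rewrite -integral12_prod_meas1// /fubini_F/=.
have iY' : m2.-integrable setT EFin.
  by apply: (integrable_pushforward (phi := Y)) => //; apply/measurable_EFinP.
have iX' : m1.-integrable setT EFin.
  by apply: (integrable_pushforward (phi := X)) => //; apply/measurable_EFinP.
transitivity (\int[m1]_x (x%:E * \int[m2]_y y%:E)).
  by apply: eq_integral => x _; rewrite -integralZl.
have EY : \int[m2]_y y%:E = \int[P]_w (Y w)%:E.
  exact: (@integral_distribution _ _ _ _ _ P Y EFin).
have EX : \int[m1]_y y%:E = \int[P]_w (X w)%:E.
  exact: (@integral_distribution _ _ _ _ _ P X EFin).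
have Yfin : \int[P]_w (Y w)%:E \is a fin_num by exact: integrable_fin_num.
by rewrite EY -(fineK Yfin) integralZr// EX.
Qed.

Lemma positive_integral0 (A : set T) (f : T -> R) : measurable A ->
  P.-integrable A (EFin \o f) -> (forall w, A w -> 0 < f w)%R ->
  \int[P]_(w in A) (f w)%:E = 0 -> P A = 0.
Proof.
move=> mA fi f0 If0.
have [N [mN N0 AN]] : ae_eq P A (EFin \o f) (cst 0).
  apply/ae_eq_integral_abs => //; first exact: measurable_int fi.
  rewrite -[RHS]If0; apply: eq_integral => w /[!inE] Aw.
  by rewrite /= gtr0_norm// f0.
apply: (subset_measure0 mA mN) => // w Aw; apply: AN => /= /(_ Aw) [fw].
by have := f0 _ Aw; rewrite fw ltxx.
Qed.
End Independence.

Section ConditionalExpectation.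
Context {disp : measure_display} {T : measurableType disp} {R : realType}.
Variables (P : probability T R) (D : set nat) (X : nat -> {RV P >-> R}).
Local Notation Gen :=
  (\bigcup_(t in D) preimage_set_system setT (X t : T -> R) measurable).
Local Notation G := (sigma_of D (fun t => X t : T -> R)).
Local Notation TG := (g_sigma_algebraType Gen).

Lemma sigma_of_measurable A : G A -> measurable A.
Proof.
apply: smallest_sub; first exact: sigma_algebra_measurable.
by move=> B [t _ [C mC <-]]; rewrite setTI; exact: measurable_funPTI.
Qed.

Lemma sigma_of_preimage t (B : set R) : D t -> measurable B -> G (X t @^-1` B).
Proof.
move=> Dt mB; apply: sub_sigma_algebra; exists t => //; exists B => //.
by rewrite setTI.
Qed.

Lemma sigma_of_measurable_fun (f : T -> R) :
  (forall B : set R, measurable B -> G (f @^-1` B)) ->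
  measurable_fun setT (f : TG -> R).
Proof. by move=> fG _ B mB; rewrite setTI; exact: fG. Qed.

(* [M] need not be integrable: work on the sets [|M| <= k]. *)
Lemma condexp_version (M E Z : T -> R) :
  measurable_fun setT (M : TG -> R) ->
  (forall A, G A -> P.-integrable A (EFin \o E) /\ (\int[P]_(w in A) (E w)%:E = 0)%E) ->
  is_conditional_expectation P G (fun w => M w + E w) Z ->
  {ae P, forall w, Z w = M w}.
Proof.
move=> mM E0 [/sigma_of_measurable_fun mZ _ Zint].
have mMT : measurable_fun setT M.
  move=> _ B mB; rewrite setTI; apply: sigma_of_measurable.
  by have := mM measurableT B mB; rewrite setTI.
pose bd (k : nat) := [set w | `|M w| <= k%:R].
have Gbd k : G (bd k).
  have : measurable_fun setT ((fun w => `|M w| <= k%:R) : TG -> bool).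
    apply: measurable_fun_ler => //; exact: measurableT_comp.
  by move=> /(_ measurableT [set true]); rewrite setTI; apply.
have key A k : G A -> A `<=` bd k ->
    [/\ P.-integrable A (EFin \o M), P.-integrable A (EFin \o Z) &
        \int[P]_(w in A) (Z w)%:E = \int[P]_(w in A) (M w)%:E]%E.
  move=> GA Ak; have mA := sigma_of_measurable GA.
  have [iE IE] := E0 _ GA.
  have iM : P.-integrable A (EFin \o M).
    apply: measurable_bounded_integrable => //.
    - by rewrite (le_lt_trans (probability_le1 P mA)) ?ltry.
    - exact: measurable_funTS.
    - exists k%:R; split => // x kx w /Ak /=; rewrite /bd/= => Mk.
      exact: le_trans Mk (ltW kx).
  have iME : P.-integrable A (EFin \o (fun w => M w + E w)).
    exact: (integrableD mA iM iE).
  have [iZ IZ] := Zint _ GA iME.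
  by split=> //; rewrite IZ integralD_EFin// IE adde0.
have union (A : set T) : G A -> (forall k, P (A `&` bd k) = 0%E) -> P A = 0%E.
  move=> GA Ak; have -> : A = \bigcup_k (A `&` bd k).
    rewrite -setI_bigcupr; apply/esym/setIidl => w _.
    exists (Num.truncn `|M w|).+1 => //; rewrite /bd/=.
    by apply: ltW; exact: truncnS_gt.
  apply/eqP; rewrite eq_le measure_ge0 andbT.
  have mk k : measurable (A `&` bd k).
    by apply: measurableI; exact: sigma_of_measurable.
  apply: le_trans (measure_sigma_subadditive _ mk _ _) _ => //.
    exact: bigcup_measurable.
  by rewrite eseries0// => k _ _; rewrite [LHS]Ak.
have Glt (f g : T -> R) : measurable_fun setT (f : TG -> R) ->
    measurable_fun setT (g : TG -> R) -> G [set w | f w < g w].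
  move=> mf mg; have : measurable_fun setT ((fun w => f w < g w) : TG -> bool).
    exact: measurable_fun_ltr.
  by move=> /(_ measurableT [set true]); rewrite setTI; apply.
have GI (A B : set T) : G A -> G B -> G (A `&` B) by exact: (@measurableI _ TG).
have null (f g : T -> R) A : G A -> (forall w, A w -> f w < g w) ->
    P.-integrable A (EFin \o f) -> P.-integrable A (EFin \o g) ->
    (\int[P]_(w in A) (f w)%:E = \int[P]_(w in A) (g w)%:E)%E -> P A = 0%E.
  move=> GA fg fi gi fgE; have mA := sigma_of_measurable GA.
  apply: (@positive_integral0 _ _ _ P _ (fun w => g w - f w)) => //.
  - exact: (integrableB mA gi fi).
  - by move=> w /fg; rewrite subr_gt0.
  - by rewrite integralB_EFin// fgE subee//; exact: integrable_fin_num.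
(* [Z < M] is an event of [G]; on each truncation of it the two integrals agree, so the truncation
   is null. *)
have lt0 : P [set w | Z w < M w] = 0%E.
  apply: union => [|k]; first exact: Glt.
  have GA := GI _ _ (Glt _ _ mZ mM) (Gbd k).
  have [iM iZ ZM] := key _ k GA (@subIsetr _ _ _).
  by apply: (null Z M) => // w [].
have gt0 : P [set w | M w < Z w] = 0%E.
  apply: union => [|k]; first exact: Glt.
  have GA := GI _ _ (Glt _ _ mM mZ) (Gbd k).
  have [iM iZ ZM] := key _ k GA (@subIsetr _ _ _).
  by apply: (null M Z) => // w [].
have mlt := sigma_of_measurable (Glt _ _ mZ mM).
have mgt := sigma_of_measurable (Glt _ _ mM mZ).
exists ([set w | Z w < M w] `|` [set w | M w < Z w]); split.
- exact: measurableU.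
- by rewrite measureU0.
- by move=> w /= /eqP; rewrite neq_lt => /orP[]; [left|right].
Qed.

End ConditionalExpectation.

(** * Square-integrable variables and orthogonal sums *)

Section SecondMoments.
Context {disp : measure_display} {T : measurableType disp} {R : realType}.
Variable P : probability T R.
Local Open Scope ereal_scope.

Lemma integrable_sqr (X : {RV P >-> R}) :
  \int[P]_w (X w ^+ 2)%:E < +oo -> P.-integrable setT (fun w => (X w ^+ 2)%:E).
Proof.
move=> X2; apply/integrableP; split.
  by apply/measurable_EFinP; exact: measurable_funX.
apply: le_lt_trans X2; rewrite le_eqVlt; apply/orP; left; apply/eqP.
by apply: eq_integral => w _; rewrite gee0_abs// lee_fin sqr_ge0.
Qed.

Lemma integrable_mul (X Y : {RV P >-> R}) :
  P.-integrable setT (fun w => (X w ^+ 2)%:E) ->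
  P.-integrable setT (fun w => (Y w ^+ 2)%:E) ->
  P.-integrable setT (fun w => (X w * Y w)%:E).
Proof.
move=> iX iY; apply: (le_integrable measurableT _ _ (integrableD measurableT iX iY)).
  by apply/measurable_EFinP; exact: measurable_funM.
move=> w _; rewrite -EFinD/= lee_fin [leRHS]ger0_norm ?addr_ge0 ?sqr_ge0//.
rewrite ler_norml; apply/andP; split.
  have := sqr_ge0 (X w + Y w); rewrite sqrrD.
  by have := sqr_ge0 (X w); have := sqr_ge0 (Y w); lra.
have := sqr_ge0 (X w - Y w); rewrite sqrrB.
by have := sqr_ge0 (X w); have := sqr_ge0 (Y w); lra.
Qed.

Lemma integrable_of_sqr (X : {RV P >-> R}) :
  P.-integrable setT (fun w => (X w ^+ 2)%:E) -> P.-integrable setT (EFin \o X).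
Proof.
move=> iX; have i1 : P.-integrable setT (fun w => (cst 1%R w : R)%:E).
  exact: finite_measure_integrable_cst.
apply: (le_integrable measurableT _ _ (integrableD measurableT iX i1)).
  by apply/measurable_EFinP.
move=> w _; rewrite -EFinD/= lee_fin [leRHS]ger0_norm ?addr_ge0 ?sqr_ge0//.
rewrite ler_norml; apply/andP; split.
  by have := sqr_ge0 (X w + 1); rewrite sqrrD; have := sqr_ge0 (X w); lra.
by have := sqr_ge0 (X w - 1); rewrite sqrrB; have := sqr_ge0 (X w); lra.
Qed.

(** Factor the mean of [X] times the indicator of [A]. Applied to the errors and the events of the
    trend, it makes the noise part of the estimate conditionally centred. *)
Lemma integral_indep0 (X : {RV P >-> R}) (A : set T) : measurable A ->
  P.-integrable setT (EFin \o X) -> \int[P]_w (X w)%:E = 0 ->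
  (forall C B : set R, measurable C -> measurable B ->
    P (X @^-1` C `&` \1_A @^-1` B) = P (X @^-1` C) * P (\1_A @^-1` B)) ->
  P.-integrable A (EFin \o X) /\ \int[P]_(w in A) (X w)%:E = 0.
Proof.
move=> mA iX X0 ind; split; first exact: integrableS iX.
have E w : (X w * \1_A w)%:E = ((fun w => (X w)%:E) \_ A) w.
  rewrite patchE indicE; case: (w \in A); first by rewrite mulr1.
  by rewrite mulr0.
rewrite integral_mkcond -(eq_integral _ _ (fun w _ => E w)).
pose Y : {RV P >-> R} := indic_mfun A mA.
rewrite (@expectation_indepM _ _ _ P X Y)//; first by rewrite X0 mul0e.
- by rewrite /Y/=; exact: integrable_indic.
- under eq_fun do rewrite E.
  by apply/(integrable_mkcond _ mA); exact: integrableS iX.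
Qed.

Lemma integral_sum_cond (I : Type) (r : seq I) (Q : pred I) (f : I -> T -> \bar R) :
  (forall i, Q i -> P.-integrable setT (f i)) ->
  \int[P]_w (\sum_(i <- r | Q i) f i w) = \sum_(i <- r | Q i) \int[P]_w f i w.
Proof.
move=> fi; elim: r => [|i r IHr].
  by rewrite big_nil; under eq_integral do rewrite big_nil; rewrite integral0.
rewrite big_cons; under eq_integral do rewrite big_cons.
case: ifPn => Qi; last by rewrite IHr.
by rewrite integralD// ?IHr//; [exact: fi|exact: integrable_sum].
Qed.

Lemma integral_sum_sqr (n m : nat) (Q : pred 'I_m) (a : 'I_n -> 'I_m -> R)
    (X : 'I_m -> {RV P >-> R}) (s2 : R) :
  (forall i, Q i -> P.-integrable setT (fun w => (X i w ^+ 2)%:E)) ->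
  (forall i, Q i -> \int[P]_w (X i w ^+ 2)%:E = s2%:E) ->
  (forall i j, Q i -> Q j -> i != j -> \int[P]_w (X i w * X j w)%:E = 0) ->
  \int[P]_w (\sum_(t < n) (\sum_(i < m | Q i) a t i * X i w) ^+ 2)%:E =
  (s2 * \sum_(t < n) \sum_(i < m | Q i) a t i ^+ 2)%:E.
Proof.
move=> iX X2 X0.
have iXX i j : Q i -> Q j -> P.-integrable setT (fun w => (X i w * X j w)%:E).
  by move=> Qi Qj; apply: integrable_mul; exact: iX.
transitivity (\int[P]_w (\sum_(t < n) \sum_(i < m | Q i) \sum_(j < m | Q j)
    ((a t i * a t j)%:E * (X i w * X j w)%:E))).
  apply: eq_integral => w _; rewrite -sumEFin; apply: eq_bigr => t _.
  rewrite expr2 mulr_suml -sumEFin; apply: eq_bigr => i _.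
  rewrite mulr_sumr -sumEFin; apply: eq_bigr => j _.
  by rewrite -EFinM mulrACA.
have i3 t i j : Q i -> Q j ->
    P.-integrable setT (fun w => (a t i * a t j)%:E * (X i w * X j w)%:E).
  by move=> Qi Qj; apply: integrableZl => //; exact: iXX.
rewrite integral_sum_cond//; last first.
  move=> t _; apply: integrable_sum => // i Qi.
  by apply: integrable_sum => // j Qj; exact: i3.
rewrite mulr_sumr -sumEFin; apply: eq_bigr => t _.
rewrite integral_sum_cond//; last first.
  by move=> i Qi; apply: integrable_sum => // j Qj; exact: i3.
rewrite mulr_sumr -sumEFin; apply: eq_bigr => i Qi.
rewrite integral_sum_cond//; last by move=> j Qj; exact: i3.
rewrite (bigD1 i)//= big1 ?adde0 => [|j /andP[Qj ji]].
  rewrite integralZl//; last exact: iXX.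
  have -> : \int[P]_w (X i w * X i w)%:E = s2%:E := X2 i Qi.
  by rewrite -EFinM mulrC -expr2.
by rewrite integralZl ?X0 ?mule0// 1?eq_sym//; exact: iXX.
Qed.

End SecondMoments.

(** * The mean square bias *)

Section PenalizedLeastSquares.
Context {R : realType} {m : nat}.
Local Notation n := m.+1.
Local Notation U := (@diff_row R m).

Lemma pls_criterionE d nu (y x : nat -> R) :
  pls_criterion d n nu y x =
  dot (@sample R m y - sample x) (sample y - sample x)
  + nu * \sum_(i < n | (d <= i)%N) dot (U d i) (sample x) ^+ 2.
Proof.
rewrite /pls_criterion; congr (_ + _ * _).
  rewrite big_add1/= big_mkord dotE; apply: eq_bigr => i _.
  by rewrite !mxE expr2.
rewrite big_add1/= big_geq_mkord; apply: eq_bigr => i di.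
by rewrite dot_diff_row_sample.
Qed.

Lemma pls_estimateE d nu (y x : nat -> R) : 0 <= nu ->
  is_pls_estimate d n nu y x ->
  sample x = invmx (penalty_mx nu (U d) d) *m sample y.
Proof.
move=> nu0 xmin; apply: penalized_min => // z.
(* Every vector is the sample of some sequence, so minimality over sequences passes to vectors. *)
pose x' (t : nat) : R := z (inord t.-1) 0.
have <- : sample x' = z by apply/colP => i; rewrite mxE /x' inord_val.
by have := xmin x'; rewrite !pls_criterionE.
Qed.

(** [B x - x = B (x - A x) = - nu B D'D x]. Only [D x] appears, so a polynomial part of degree below
    [d] leaves no trace in the bias. *)
Lemma pls_bias d nu (x : nat -> R) i : 0 <= nu ->
  let B := invmx (penalty_mx nu (U d) d) in
  (B *m sample x) i 0 - x i.+1 =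
  - nu * \sum_(k < n | (d <= k)%N) (B *m U d k) i 0 * iter d nabla x k.+1.
Proof.
move=> nu0 B; have dA := dominates1_penalty (U d) d nu0.
have -> : x i.+1 = (sample x) i 0 by rewrite mxE.
have -> : (B *m sample x) i 0 - sample x i 0 = (B *m sample x - sample x) i 0.
  by rewrite !mxE.
rewrite -[X in _ - X](mulKmx (dominates1_unit dA)) -/B -mulmxBr.
rewrite [X in B *m X](_ : _ =
    - nu *: \sum_(k < n | (d <= k)%N) (iter d nabla x k.+1 *: U d k)).
  rewrite -scalemxAr mxE; congr (_ * _).
  rewrite mulmx_sumr summxE; apply: eq_bigr => k _.
  by rewrite -scalemxAr mxE mulrC.
rewrite mulmxDl mul1mx opprD addrA subrr add0r -scalemxAl -scaleNr; congr (_ *: _).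
rewrite mulmx_suml; apply: eq_bigr => k dk.
by rewrite outer_mul dot_diff_row_sample.
Qed.

End PenalizedLeastSquares.

Section MeanSquareBias.
Context {disp : measure_display} {T : measurableType disp} {R : realType}.
Variables (P : probability T R) (m d : nat) (nu s2 : R).
Variables (mu gamma eps : nat -> {RV P >-> R}) (Y muhat mubar : nat -> T -> R).
Local Notation n := m.+1.
Hypotheses (nu_gt0 : 0 < nu)
  (model : forall (t : nat) (w : T), (1 <= t <= n)%N -> Y t w = mu t w + eps t w)
  (eps_mean0 : forall t, ('E_P[eps t] = 0)%E)
  (eps_sqr : forall t, ('E_P[(fun w => eps t w ^+ 2)%R] < +oo)%E)
  (trend : forall (t : nat) (w : T), (d.+1 <= t <= n)%N ->
     iter d nabla (fun s => mu s w) t = gamma t w)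
  (gamma_indep : mutually_independent P [set t | (d.+1 <= t <= n)%N]
     (fun t => gamma t : T -> R))
  (gamma_mean0 : forall t, (d.+1 <= t <= n)%N -> ('E_P[gamma t] = 0)%E)
  (gamma_var : forall t, (d.+1 <= t <= n)%N -> ('V_P[gamma t] = s2%:E)%E)
  (eps_mu_indep : independent_sigma P
     (sigma_of setT (fun t => eps t : T -> R))
     (sigma_of [set t | (1 <= t <= n)%N] (fun t => mu t : T -> R)))
  (muhat_pls : forall w,
     is_pls_estimate d n nu (fun t => Y t w) (fun t => muhat t w))
  (mubar_condexp : forall t, (1 <= t <= n)%N ->
     is_conditional_expectation P
       (sigma_of [set s | (1 <= s <= n)%N] (fun s => mu s : T -> R))
       (muhat t) (mubar t)).
Local Notation G :=
  (sigma_of [set s | (1 <= s <= n)%N] (fun s => mu s : T -> R)).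
Local Notation U := (@diff_row R m d).

Let A := penalty_mx nu U d.
Let B := invmx A.
Let M (i : 'I_n) (w : T) : R := \sum_(s < n) B i s * mu s.+1 w.
Let E (i : 'I_n) (w : T) : R := \sum_(s < n) B i s * eps s.+1 w.

Let muhatE (i : 'I_n) w : muhat i.+1 w = M i w + E i w.
Proof.
have /(congr1 (fun v : 'cV_n => v i 0)) := pls_estimateE (ltW nu_gt0) (muhat_pls w).
rewrite mxE => ->; rewrite mxE -big_split/=; apply: eq_bigr => s _.
by rewrite mxE model ?ltn_ord// mulrDr.
Qed.

Let G_eps t (C : set T) : G C ->
  P.-integrable C (EFin \o eps t) /\ (\int[P]_(w in C) (eps t w)%:E = 0)%E.
Proof.
move=> GC; have mC := sigma_of_measurable GC.
have i2 : P.-integrable setT (fun w => (eps t w ^+ 2)%:E).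
  by apply: integrable_sqr; have := eps_sqr t; rewrite unlock.
apply: integral_indep0 => //.
- exact: integrable_of_sqr.
- by have := eps_mean0 t; rewrite unlock.
- move=> C1 C2 mC1 mC2; apply: eps_mu_indep.
    exact: sigma_of_preimage.
  suff : measurable_fun setT (\1_C :
      g_sigma_algebraType (\bigcup_(t in [set s | (1 <= s <= n)%N])
        preimage_set_system setT (mu t : T -> R) measurable) -> R).
    by move=> /(_ measurableT _ mC2); rewrite setTI.
  exact: measurable_indic.
Qed.

(** [M i] is a linear combination of the trend values, hence [G]-measurable, while [E i] integrates
    to 0 over every event of [G]. *)
Let mubarE (i : 'I_n) : {ae P, forall w, mubar i.+1 w = M i w}.
Proof.
have i1 : (1 <= i.+1 <= n)%N by rewrite ltn_ord.
have cond := mubar_condexp i1.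
have muE : muhat i.+1 = (fun w => M i w + E i w) by apply/funext => w; exact: muhatE.
rewrite muE in cond.
apply: condexp_version cond.
- apply: measurable_sum => s; apply: measurable_funM => //.
  apply: sigma_of_measurable_fun => C mC; apply: sigma_of_preimage => //=.
- move=> C GC; have mC := sigma_of_measurable GC.
  have iE s : P.-integrable C (fun w => (B i s)%:E * (eps s.+1 w)%:E)%E.
    by apply: integrableZl => //; exact: (G_eps s.+1 GC).1.
  have EE w : (E i w)%:E = (\sum_(s < n) (B i s)%:E * (eps s.+1 w)%:E)%E.
    by rewrite /E -sumEFin.
  have EE' : EFin \o E i = (fun w => \sum_(s < n) (B i s)%:E * (eps s.+1 w)%:E)%E.
    by apply/funext => w; exact: EE.
  split; first by rewrite EE'; exact: integrable_sum.
  rewrite (eq_integral _ _ (fun w _ => EE w)) integral_sum// big1// => s _.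
  by rewrite integralZl// ?(G_eps s.+1 GC).2 ?mule0//; exact: (G_eps s.+1 GC).1.
Qed.

Let measurable_mubar t : (1 <= t <= n)%N -> measurable_fun setT (mubar t).
Proof.
move=> t1 _ C mC; rewrite setTI; have [+ _ _] := mubar_condexp t1.
by move=> /(_ C mC) /sigma_of_measurable.
Qed.

Let in_range (k : 'I_n) : (d <= k)%N -> (d.+1 <= k.+1 <= n)%N.
Proof. by move=> dk; rewrite ltnS dk ltn_ord. Qed.

Let gamma_sqr t : (d.+1 <= t <= n)%N ->
  P.-integrable setT (fun w => (gamma t w ^+ 2)%:E) /\
  (\int[P]_w (gamma t w ^+ 2)%:E = s2%:E)%E.
Proof.
move=> dt; have := gamma_var dt; rewrite /variance unlock gamma_mean0//= unlock => V.
have V' : (\int[P]_w (gamma t w ^+ 2)%:E = s2%:E)%E.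
  rewrite -V; apply: eq_integral => w _; congr EFin.
  by rewrite !fctE /= subr0 expr2.
by split=> //; apply: integrable_sqr; rewrite V' ltry.
Qed.

Let gamma_orth s t : (d.+1 <= s <= n)%N -> (d.+1 <= t <= n)%N -> s != t ->
  (\int[P]_w (gamma s w * gamma t w)%:E = 0)%E.
Proof.
move=> ds dt st; have [is2 _] := gamma_sqr ds; have [it2 _] := gamma_sqr dt.
rewrite expectation_indepM.
- by have := gamma_mean0 ds; rewrite unlock => ->; rewrite mul0e.
- move=> C1 C2 mC1 mC2.
  have := @gamma_indep [:: s; t] (fun k => if k == s then C1 else C2).
  rewrite bigcap_seq !big_cons !big_nil eqxx eq_sym (negbTE st) setIT mule1.
  apply.
  + by rewrite /= inE st.
  + by move=> k; rewrite !inE => /orP[] /eqP ->.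
  + by move=> k; case: ifP.
- exact: integrable_of_sqr.
- exact: integrable_of_sqr.
- exact: integrable_mul.
Qed.

(** Exact for each sample size: orthogonality leaves [nu^2 s2] times the squared Frobenius norm of
    [B D'], and [sum_sqr_penalty] absorbs one factor [nu]. *)
Lemma mean_square_bias :
  ('E_P[(fun w => euclidean_norm n (fun t => mubar t w - mu t w) ^+ 2)%R]
   = (nu * s2 * trace_gap (penalty_mx nu (@diff_row R m d) d))%:E)%E.
Proof.
rewrite unlock.
transitivity (\int[P]_w (\sum_(i < n)
   (\sum_(k < n | (d <= k)%N) (- nu * (B *m U k) i 0) * gamma k.+1 w) ^+ 2)%:E)%E.
  have normE w : euclidean_norm n (fun t => mubar t w - mu t w) ^+ 2 =
      \sum_(i < n) (mubar i.+1 w - mu i.+1 w) ^+ 2.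
    rewrite /euclidean_norm sqr_sqrtr ?sumr_ge0// => [|i _]; last exact: sqr_ge0.
    by rewrite big_add1/= big_mkord.
  have mbar (i : 'I_n) : measurable_fun setT (mubar i.+1).
    by apply: measurable_mubar; rewrite ltn_ord.
  under eq_integral do rewrite normE.
  apply: ae_eq_integral => //.
  - apply/measurable_EFinP; apply: measurable_sum => i.
    by apply: measurable_funX; exact: measurable_funB.
  - apply/measurable_EFinP; apply: measurable_sum => i; apply: measurable_funX.
    under eq_fun do rewrite big_mkcond/=.
    apply: measurable_sum => k; case: (d <= k)%N => //.
    exact: measurable_funM.
  - apply: filterS (filter_forall _ mubarE) => w barE _; congr EFin.
    apply: eq_bigr => i _; congr (_ ^+ 2); rewrite barE.
    have -> : M i w = (B *m sample (fun t => mu t w)) i 0.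
      by rewrite mxE; apply: eq_bigr => s _; rewrite mxE.
    rewrite [LHS](pls_bias d (fun t => mu t w) i (ltW nu_gt0)) mulr_sumr.
    apply: eq_bigr => k dk; rewrite mulrA trend//.
    exact: in_range.
rewrite (@integral_sum_sqr _ _ _ P _ _ (fun k : 'I_n => (d <= k)%N)
   (fun i k => - nu * (B *m U k) i 0) (fun k => gamma k.+1) s2); last 3 first.
- by move=> k dk; exact: (gamma_sqr (in_range dk)).1.
- by move=> k dk; exact: (gamma_sqr (in_range dk)).2.
- by move=> k l dk dl kl; apply: gamma_orth; rewrite ?in_range.
congr EFin; have := sum_sqr_penalty U d (ltW nu_gt0).
rewrite -/A => <-.
rewrite !mulr_sumr; apply: eq_bigr => i _; rewrite !mulr_sumr; apply: eq_bigr => k _.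
by rewrite -/B; ring.
Qed.

End MeanSquareBias.

(** * From the exact formula to the relative error *)

(** Share [r] between the two remainders in proportion to [a] and [b]; the common quotient
    [r / (a + b)] is bounded by [C]. *)
Lemma bigO_split (R : realType) (r a b : nat -> R) (C : R) : 0 < C ->
  (\forall n \near \oo, [/\ 0 < a n, 0 < b n & `|r n| <= C * (a n + b n)]) ->
  exists r1 r2 : nat -> R, [/\ r1 =O_\oo a, r2 =O_\oo b &
    \forall n \near \oo, r n = r1 n + r2 n].
Proof.
move=> C0 rab.
exists (fun n => r n / (a n + b n) * a n), (fun n => r n / (a n + b n) * b n).
have bound n : [/\ 0 < a n, 0 < b n & `|r n| <= C * (a n + b n)] ->
    `|r n / (a n + b n)| <= C.
  move=> [a0 b0 rn]; rewrite normrM normfV (gtr0_norm (addr_gt0 a0 b0)).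
  by rewrite ler_pdivrMr ?addr_gt0.
split.
- apply/eqO_exP; exists C => //; apply: filterS rab => n rn.
  by rewrite normrM ler_wpM2r// bound.
- apply/eqO_exP; exists C => //; apply: filterS rab => n rn.
  by rewrite normrM ler_wpM2r// bound.
- apply: filterS rab => n [a0 b0 _].
  by rewrite -mulrDr divfK// gt_eqF// addr_gt0.
Qed.

Theorem theorem2 (R : realType) (d : nat) (tau : R) (nu : nat -> R)
  (disp : measure_display) (T : nat -> measurableType disp)
  (P : forall n : nat, probability (T n) R)
  (mu gamma eps : forall n : nat, nat -> {RV (P n) >-> R})
  (Y muhat mubar : forall n : nat, nat -> T n -> R)
  (d_ge1 : (1 <= d)%N)
  (tau_gt0 : 0 < tau)
  (* Y_t = mu_t + eps_t *)
  (model : forall (n t : nat) (w : T n), (1 <= t <= n)%N ->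
     Y n t w = mu n t w + eps n t w)
  (* the errors *)
  (eps_mean0 : forall n t : nat, ('E_(P n)[eps n t] = 0)%E)
  (eps_stationary : forall n : nat,
     stationary (P n) (fun t => eps n t : T n -> R))
  (* the trend *)
  (trend : forall (n t : nat) (w : T n), (d.+1 <= t <= n)%N ->
     iter d nabla (fun s => mu n s w) t = gamma n t w)
  (gamma_iid : forall n : nat,
     iid (P n) [set t | (d.+1 <= t <= n)%N] (fun t => gamma n t : T n -> R))
  (gamma_mean0 : forall n t : nat, (d.+1 <= t <= n)%N ->
     ('E_(P n)[gamma n t] = 0)%E)
  (gamma_var : forall n t : nat, (d.+1 <= t <= n)%N ->
     ('V_(P n)[gamma n t] = (tau ^+ 2 / n%:R ^+ (2 * d - 1))%:E)%E)
  (* independence of the errors from the innovations and from the trend *)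
  (eps_gamma_indep : forall n : nat,
     independent_sigma (P n)
       (sigma_of setT (fun t => eps n t : T n -> R))
       (sigma_of [set t | (d.+1 <= t <= n)%N]
          (fun t => gamma n t : T n -> R)))
  (eps_mu_indep : forall n : nat,
     independent_sigma (P n)
       (sigma_of setT (fun t => eps n t : T n -> R))
       (sigma_of [set t | (1 <= t <= n)%N] (fun t => mu n t : T n -> R)))
  (* muhat is the penalized least squares estimate *)
  (nu_gt0 : forall n : nat, 0 < nu n)
  (muhat_pls : forall (n : nat) (w : T n),
     is_pls_estimate d n (nu n) (fun t => Y n t w) (fun t => muhat n t w))
  (* mubar = E(muhat | mu) *)
  (mubar_condexp : forall n t : nat, (1 <= t <= n)%N ->
     is_conditional_expectation (P n)
       (sigma_of [set s | (1 <= s <= n)%N] (fun s => mu n s : T n -> R))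
       (muhat n t) (mubar n t))
  (nu_infty : nu n @[n --> \oo] --> +oo)
  (nu_small : nu n / n%:R ^+ (2 * d) @[n --> \oo] --> (0 : R)) :
  let c2 : R :=
    tau ^+ 2 * Beta (1 + (2 * d)%:R^-1) (1 - (2 * d)%:R^-1) / ((2 * d)%:R * pi)
  in
  exists r1 r2 : nat -> R,
    [/\ r1 =O_\oo (fun n => nu n `^ (- (2 * d)%:R^-1)),
        r2 =O_\oo (fun n => nu n `^ ((2 * d)%:R^-1) / n%:R) &
        \forall n \near \oo,
          ('E_(P n)[(fun w => euclidean_norm n
                        (fun t => mubar n t w - mu n t w) ^+ 2)%R]
             * (n%:R^-1)%:E
           = (c2 * (nu n `^ ((2 * d)%:R^-1) / n%:R) ^+ (2 * d - 1)
                * (1 + r1 n + r2 n))%:E)%E].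
Proof.
set a := (2 * d)%:R^-1; set B := Beta _ _ => c2.
have p_gt0 : (0 < 2 * d)%N by rewrite muln_gt0.
have p2 : (2 <= 2 * d)%N by rewrite -[X in (X <= _)%N]muln1 leq_mul2l.
have pR0 : 0 < (2 * d)%:R :> R by rewrite ltr0n.
have B0 : 0 < B by exact: Beta_gt0.
pose b : R := B / ((2 * d)%:R * pi).
have b0 : 0 < b by rewrite divr_gt0 ?mulr_gt0 ?pi_gt0.
pose z n := nu n `^ a.
(* [diff_row] lives in dimension [m.+1], hence [n.-1]; this is dimension [n] as soon as [n >= 1]. *)
pose g n := trace_gap (penalty_mx (nu n) (@diff_row R n.-1 d) d).
pose r n := z n / n%:R / b * g n - 1.
(* Relative to [n * b / z], the bound of [trace_gap_asymp] is [((2d + 8) z / n + 2 / z) / b];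
   [2d + 10] dominates both coefficients. *)
pose C : R := ((2 * d)%:R + 10) / b.
have C0 : 0 < C by rewrite divr_gt0 ?addr_gt0.
have large : \forall n \near \oo, 1 <= nu n /\ (d < n)%N.
  near=> n; split; first by near: n; move/cvgryPge : nu_infty; exact.
  by near: n; exact: nbhs_infty_gt.
have zP n : 1 <= nu n -> 1 <= z n /\ nu n = z n ^+ (2 * d).
  move=> nu1; split; first by rewrite -(powRr0 (nu n)) ler_powR// invr_ge0 ltW.
  by rewrite /z -powR_mulrn ?powR_ge0// -powRrM mulVf ?gt_eqF// powRr1// ltW.
have rC : \forall n \near \oo, [/\ 0 < nu n `^ (- a), 0 < nu n `^ a / n%:R &
    `|r n| <= C * (nu n `^ (- a) + nu n `^ a / n%:R)].
  apply: filterS large => -[|m] [nu1 dn]; first by [].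
  have [z1 zE] := zP _ nu1; have z0 : 0 < z m.+1 by exact: lt_le_trans z1.
  split; [exact: powR_gt0|by rewrite divr_gt0 ?powR_gt0|].
  rewrite powRN -/(z m.+1); have := trace_gap_asymp d_ge1 dn z1 zE.
  rewrite -/a -/B -/b -[trace_gap _]/(g m.+1).
  set n : R := m.+1%:R; have n0 : 0 < n by rewrite ltr0n.
  set w := z m.+1 in z0 z1 *; move=> gb.
  have -> : r m.+1 = w / n / b * (g m.+1 - n / w * b).
    by rewrite /r -/n -/w; field; rewrite !gt_eqF.
  have w0 : 0 < w / n / b by exact: divr_gt0 (divr_gt0 z0 n0) b0.
  rewrite normrM (gtr0_norm w0); apply: le_trans (ler_wpM2l (ltW w0) gb) _.
  have -> : w / n / b * ((2 * d)%:R + 8 + 2 * (n / w ^+ 2)) =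
      (((2 * d)%:R + 8) * (w / n) + 2 * w^-1) / b.
    by field; rewrite !gt_eqF.
  rewrite /C mulrAC ler_wpM2r ?invr_ge0 ?(ltW b0)//.
  have q0 : 0 < w / n by rewrite divr_gt0.
  have q1 : 0 < w^-1 by rewrite invr_gt0.
  have pq := mulr_gt0 pR0 q1; move: q0 q1 pq; clear.
  by move: (2 * d)%:R (w / n) w^-1 => p x y; lra.
have [r1 [r2 [r1O r2O rE]]] := bigO_split C0 rC.
exists r1, r2; split => //.
apply: filterS2 large rE => -[|m] [nu1 dn] rm; first by [].
have [z1 zE] := zP _ nu1; have z0 : 0 < z m.+1 by exact: lt_le_trans z1.
have [eps_sqr _ _] := eps_stationary m.+1.
have [gi _] := gamma_iid m.+1.
rewrite (mean_square_bias (nu_gt0 m.+1) (@model m.+1) (eps_mean0 m.+1) eps_sqr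
  (@trend m.+1) gi (@gamma_mean0 m.+1) (@gamma_var m.+1) (eps_mu_indep m.+1)
  (@muhat_pls m.+1) (@mubar_condexp m.+1)).
(* As [1 + r = z g / (n b)], what remains is the identity [nu tau^2 g / n^(2d) = tau^2 b (z /
   n)^(2d-1) (1 + r)] with [nu = z^(2d)]. *)
rewrite -EFinM -addrA -rm; congr EFin.
rewrite -[trace_gap _]/(g m.+1) /r -/(z m.+1).
rewrite addrC subrK /c2 -/B zE.
set n : R := m.+1%:R; have n0 : 0 < n by rewrite ltr0n.
have -> : tau ^+ 2 * B / ((2 * d)%:R * pi) = tau ^+ 2 * b by rewrite /b mulrA.
have -> : z m.+1 ^+ (2 * d) = z m.+1 * z m.+1 ^+ (2 * d - 1).
  by rewrite -exprS; congr (_ ^+ _); lia.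
move: (z m.+1) (g m.+1) z0 => w t w0; rewrite expr_div_n.
by field; rewrite ?gt_eqF ?exprn_gt0.
Unshelve. all: by end_near. Qed.
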